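(* Let $S$ be a Dedekind domain, $G$ a finite subgroup of $\mathrm{Aut}(S)$ such that $R=S^G$ is a discrete valuation ring, and assume that $S/R$ is residually separable. Let $f\in Z^2(G,S^* )$ and $T=S^f*G$. With $\hat R,\hat S,\hat T$ and $T_1=e_1\hat Te_1$ as defined in the context, the following are equivalent: (1) $T$ is a maximal $R$-order; (2) $\hat T$ is a maximal $\hat R$-order; (3) $T_1$ is a maximal $\hat R$-order. Furthermore, the three algebras $T$, $\hat T$, $T_1$ have the same number of maximal two-sided ideals.
   Context: Residually separable means that the residue field extensions of $S$ over the residue field of $R$ (i.e. $S/M$ over $R/(M\cap R)$ for maximal ideals $M$ of $S$) are separable. The crossed product $S^f*G=\bigoplus_{g\in G}SU_g$ is the free left $S$-module on symbols $U_g$ with multiplication $sU_g\,tU_h=s\,g(t)f(g,h)U_{gh}$ for $s,t\in S$, $g,h\in G$. Let $z$ generate the maximal ideal of $R$ and put $\hat R=\varprojlim_i R/z^iR$, $\hat S=\varprojlim_i S/z^iS$, $\hat T=\varprojlim_i T/z^iT$. The action of $G$ on $S$ induces an action on $\hat S$, and $\hat T\simeq\hat S*G$ is the crossed product with action and 2-cocycle induced from those of $T$; it is an $\hat R$-order. Let $e_1,\dots,e_k$ be the primitive idempotents of $\hat S$, $G_j=\{g\in G: g(e_j)=e_j\}$, and $T_j=e_j\hat Te_j=\hat Se_j*G_j$ (with $\hat S e_j$ a DVR). Each of $T$, $\hat T$, $T_1$ is regarded as an order in its own quotient ring (for $T$, this is $L^f*G$ with $L$ the field of quotients of $S$), and ''maximal''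 means maximal there. The 2-cocycles are normalized. *)

(* Defs.v *)
From HB Require Import structures.
From mathcomp Require Import all_boot all_order fingroup all_algebra.
From mathcomp Require Import generic_quotient ring_quotient separable.
From mathcomp Require Import ring.
From mathcomp Require Import boolp classical_sets functions cardinality.

Set Implicit Arguments.
Unset Strict Implicit.
Unset Printing Implicit Defensive.

Import GRing.Theory.
Local Open Scope ring_scope.
Local Open Scope quotient_scope.
Local Open Scope classical_set_scope.

(* Rings are [pzRingType]s (1 = 0 allowed) wherever the quotients A/z^0A or   *)
(* the rings built from them occur.                                           *)

Section Ideals.
Variable A : pzRingType.

(* Two-sided ideals. *)
Definition is_ideal (I : set A) : Prop :=
  [/\ I 0, (forall x y, I x -> I y -> I (x + y)),
      (forall a x, I x -> I (a * x)) & (forall a x, I x -> I (x * a))].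

Definition is_maximal_ideal (M : set A) : Prop :=
  [/\ is_ideal M, ~ M 1 &
      forall J, is_ideal J -> ~ J 1 -> M `<=` J -> J = M].

Definition maximal_ideals : set (set A) := [set M | is_maximal_ideal M].

(* Meant for a central element [a]. *)
Definition principal (a : A) : set A := [set a * x | x in setT].

Record ideal := Ideal { ideal_set :> A -> Prop; idealP : is_ideal ideal_set }.

Record max_ideal :=
  MaxIdeal { max_ideal_set :> A -> Prop; max_idealP : is_maximal_ideal max_ideal_set }.

Definition ideal_of_max (M : max_ideal) : ideal :=
  Ideal (let: And3 h _ _ := max_idealP M in h).

End Ideals.

Arguments maximal_ideals : clear implicits.

Section Quotient.
Variables (A : pzRingType) (I : ideal A).

Definition ideal_mem : A -> bool := fun x => `[< I x >].

Lemma ideal_memP x : reflect (I x) (x \in ideal_mem).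
Proof. exact: asboolP. Qed.

Lemma ideal_mem_zmod : zmod_closed ideal_mem.
Proof.
case: (idealP I) => I0 ID IM _; split; first exact/ideal_memP.
move=> x y /ideal_memP Ix /ideal_memP Iy; apply/ideal_memP.
by apply: ID => //; rewrite -mulN1r; apply: IM.
Qed.

HB.instance Definition _ := GRing.isZmodClosed.Build A ideal_mem ideal_mem_zmod.

Definition ideal_zmod := GRing.ZmodClosed.clone A ideal_mem _.

Definition quot_ring := Quotient.quot ideal_zmod.

HB.instance Definition _ := GRing.Zmodule.on quot_ring.

Definition quot_proj (x : A) : quot_ring := \pi_(Quotient.quot ideal_zmod) x.

Lemma quot_projK (x : quot_ring) : quot_proj (repr x) = x.
Proof. exact: reprK. Qed.

Lemma quot_proj_eq x y : quot_proj x = quot_proj y <-> I (x - y).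
Proof.
split=> [/eqP|] h.
  by move: h; rewrite -Quotient.idealrBE => /ideal_memP.
by apply/eqP; rewrite -Quotient.idealrBE; apply/ideal_memP.
Qed.

Lemma quot_proj0 : quot_proj 0 = 0.
Proof. exact: (raddf0 (\pi_(Quotient.quot ideal_zmod))). Qed.

Lemma quot_projB : zmod_morphism quot_proj.
Proof. exact: (raddfB (\pi_(Quotient.quot ideal_zmod))). Qed.

Lemma quot_projD : {morph quot_proj : x y / x + y}.
Proof. exact: (raddfD (\pi_(Quotient.quot ideal_zmod))). Qed.

Definition quot_one : quot_ring := quot_proj 1.
Definition quot_mul (x y : quot_ring) : quot_ring := quot_proj (repr x * repr y).

Lemma quot_mulE x y : quot_mul (quot_proj x) (quot_proj y) = quot_proj (x * y).
Proof.
apply/quot_proj_eq.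
have [_ ID IMl IMr] := idealP I.
have hx : I (repr (quot_proj x) - x) by apply/quot_proj_eq/quot_projK.
have hy : I (repr (quot_proj y) - y) by apply/quot_proj_eq/quot_projK.
have -> : repr (quot_proj x) * repr (quot_proj y) - x * y =
  (repr (quot_proj x) - x) * repr (quot_proj y) + x * (repr (quot_proj y) - y).
  by rewrite mulrBl mulrBr addrA subrK.
by apply: ID; [apply: IMr | apply: IMl].
Qed.

Lemma quot_mulA : associative quot_mul.
Proof.
move=> x y z; rewrite -[x]quot_projK -[y]quot_projK -[z]quot_projK.
by rewrite !quot_mulE mulrA.
Qed.

Lemma quot_mul1 : left_id quot_one quot_mul.
Proof. by move=> x; rewrite -[x]quot_projK quot_mulE mul1r. Qed.

Lemma quot_mulr1 : right_id quot_one quot_mul.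
Proof. by move=> x; rewrite -[x]quot_projK quot_mulE mulr1. Qed.

Lemma quot_mulDl : left_distributive quot_mul +%R.
Proof.
move=> x y z; rewrite -[x]quot_projK -[y]quot_projK -[z]quot_projK.
by rewrite -quot_projD !quot_mulE mulrDl quot_projD.
Qed.

Lemma quot_mulDr : right_distributive quot_mul +%R.
Proof.
move=> x y z; rewrite -[x]quot_projK -[y]quot_projK -[z]quot_projK.
by rewrite -quot_projD !quot_mulE mulrDr quot_projD.
Qed.

HB.instance Definition _ := GRing.Zmodule_isPzRing.Build quot_ring
  quot_mulA quot_mul1 quot_mulr1 quot_mulDl quot_mulDr.

Lemma quot_proj_monoid : monoid_morphism quot_proj.
Proof. by split=> // x y; rewrite -quot_mulE. Qed.

HB.instance Definition _ := GRing.isZmodMorphism.Build A quot_ring quot_proj quot_projB.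
HB.instance Definition _ :=
  GRing.isMonoidMorphism.Build A quot_ring quot_proj quot_proj_monoid.

End Quotient.

Section QuotientCom.
Variables (A : comPzRingType) (I : ideal A).

Lemma quot_mulC : commutative (@GRing.mul (quot_ring I)).
Proof.
move=> x y; rewrite -[x]quot_projK -[y]quot_projK.
by rewrite -!(rmorphM (@quot_proj A I)) mulrC.
Qed.

HB.instance Definition _ := GRing.PzRing_hasCommutativeMul.Build (quot_ring I) quot_mulC.

End QuotientCom.

(* The morphism A/I -> B/J induced by f : A -> B when f(I) is in J. *)
Section QuotientMap.
Variables (A B : pzRingType) (f : {rmorphism A -> B}) (I : ideal A) (J : ideal B).

Definition quot_map of (forall x, I x -> J (f x)) :=
  fun x : quot_ring I => quot_proj J (f (repr x)).

Hypothesis fIJ : forall x, I x -> J (f x).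

Lemma quot_mapE x : quot_map fIJ (quot_proj I x) = quot_proj J (f x).
Proof.
by apply/quot_proj_eq; rewrite -rmorphB; apply: fIJ; apply/quot_proj_eq/quot_projK.
Qed.

Lemma quot_map_zmod : zmod_morphism (quot_map fIJ).
Proof.
move=> x y; rewrite -[x]quot_projK -[y]quot_projK.
by rewrite -rmorphB !quot_mapE !rmorphB.
Qed.

Lemma quot_map_monoid : monoid_morphism (quot_map fIJ).
Proof.
split=> [|x y].
  by rewrite -(rmorph1 (quot_proj I)) quot_mapE !rmorph1.
rewrite -[x]quot_projK -[y]quot_projK.
by rewrite -(rmorphM (quot_proj I)) !quot_mapE !rmorphM.
Qed.

HB.instance Definition _ :=
  GRing.isZmodMorphism.Build (quot_ring I) (quot_ring J) (quot_map fIJ) quot_map_zmod.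
HB.instance Definition _ :=
  GRing.isMonoidMorphism.Build (quot_ring I) (quot_ring J) (quot_map fIJ) quot_map_monoid.

End QuotientMap.

Section ResidueField.
Variables (A : comPzRingType) (M : max_ideal A).

Definition residue_field := quot_ring (ideal_of_max M).

HB.instance Definition _ := GRing.ComPzRing.on residue_field.

Lemma residue_nonzero : (1 : residue_field) != 0.
Proof.
apply/eqP; rewrite -(rmorph1 (quot_proj (ideal_of_max M))) -(quot_proj0 (ideal_of_max M)).
by move/quot_proj_eq; rewrite subr0 /=; case: (max_idealP M).
Qed.

HB.instance Definition _ :=
  GRing.PzSemiRing_isNonZero.Build residue_field residue_nonzero.

Lemma max_ideal_inv (x : A) : ~ M x -> exists y, M (y * x - 1).
Proof.
have [[M0 MD Ml Mr] M1 Mmax] := max_idealP M => Mx.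
pose J : set A := [set u | exists y, M (u - y * x)].
have J_ideal : is_ideal J.
  split.
  - by exists 0; rewrite mul0r subr0.
  - move=> u v [y hu] [t hv]; exists (y + t).
    by rewrite mulrDl opprD addrACA; apply: MD.
  - move=> a u [y hu]; exists (a * y).
    by rewrite -mulrA -mulrBr; apply: Ml.
  - move=> a u [y hu]; exists (a * y).
    by rewrite [u * a]mulrC -mulrA -mulrBr; apply: Ml.
have MJ : M `<=` J by move=> u Mu; exists 0; rewrite mul0r subr0.
have [y hy] : J 1.
  apply: contrapT => J1; apply: Mx.
  by rewrite -(Mmax J J_ideal J1 MJ); exists 1; rewrite mul1r subrr.
by exists y; rewrite -opprB -mulN1r; apply: Ml.
Qed.

Lemma residue_inv_ex (x : residue_field) :
  {y : residue_field | (x != 0 -> y * x = 1) /\ (x = 0 -> y = 0)}.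
Proof.
apply: cid; have [->|x0] := eqVneq x 0; first by exists 0; split; rewrite ?eqxx.
have [|y hy] := @max_ideal_inv (repr x).
  move=> Mx; case/eqP: x0; rewrite -[x]quot_projK -[RHS]quot_proj0.
  by apply/quot_proj_eq; rewrite subr0.
exists (quot_proj (ideal_of_max M) y); split=> [_|/eqP]; last by rewrite (negPf x0).
rewrite -[x]quot_projK; apply: (etrans (@quot_mulE A (ideal_of_max M) y _)).
exact/quot_proj_eq.
Qed.

Definition residue_inv (x : residue_field) : residue_field := sval (residue_inv_ex x).

Lemma residue_mulV x : x != 0 -> residue_inv x * x = 1.
Proof. exact: (svalP (residue_inv_ex x)).1. Qed.

Lemma residue_inv0 : residue_inv 0 = 0.
Proof. exact: (svalP (residue_inv_ex 0)).2. Qed.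

HB.instance Definition _ :=
  GRing.ComNzRing_isField.Build residue_field residue_mulV residue_inv0.

End ResidueField.

(* K is algebraic over k, and the minimal polynomial of each of its elements *)
(* is separable.                                                             *)
Definition separable_extension (k K : fieldType) (phi : {rmorphism k -> K}) : Prop :=
  forall x : K, exists p : {poly k},
    [/\ irreducible_poly p, separable_poly p & root (map_poly phi p) x].

Section Domains.
Variable A : idomainType.

Definition is_prime_ideal (P : set A) : Prop :=
  [/\ is_ideal P, ~ P 1 & forall x y, P (x * y) -> P x \/ P y].

Definition noetherian : Prop :=
  forall I : set A, is_ideal I -> exists (n : nat) (s : 'I_n -> A),
    I = [set x | exists c : 'I_n -> A, x = \sum_i c i * s i].

Definition integrally_closed : Prop :=
  forall x : {fraction A}, integralOver (@FracField.tofrac A) x ->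
    exists a : A, x = FracField.tofrac a.

Definition is_dedekind : Prop :=
  [/\ noetherian, integrally_closed &
      forall P : set A, is_prime_ideal P -> P <> [set 0] -> is_maximal_ideal P].

Definition is_DVR : Prop :=
  [/\ (forall I : set A, is_ideal I -> exists a, I = principal a),
      (exists! m : set A, is_maximal_ideal m) &
      (exists2 a : A, a != 0 & a \isn't a GRing.unit)].

End Domains.

Record ring_action (gT : finGroupType) (S : pzRingType) := RingAction {
  act :> gT -> {rmorphism S -> S};
  act1 : forall s, act 1%g s = s;
  actM : forall g h s, act (g * h)%g s = act g (act h s)
}.

(* A faithful action is the same thing as an embedding of [gT] in Aut(S). *)
Definition faithful_action (gT : finGroupType) (S : pzRingType)
    (a : ring_action gT S) : Prop :=
  injective (fun g => a g : S -> S).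

Section FixedRing.
Variables (gT : finGroupType) (S : idomainType) (a : ring_action gT S).

Lemma actK g : cancel (a g) (a g^-1%g).
Proof. by move=> s; rewrite -actM mulVg act1. Qed.

Lemma act_inj g : injective (a g).
Proof. exact: can_inj (actK g). Qed.

Definition fixed : S -> bool := fun s => [forall g, a g s == s].

Lemma fixedP s : reflect (forall g, a g s = s) (s \in fixed).
Proof. by apply: (iffP forallP) => h g; apply/eqP. Qed.

Lemma fixed_divring : divring_closed fixed.
Proof.
split=> [|x y /fixedP hx /fixedP hy|x y /fixedP hx /fixedP hy]; apply/fixedP => g.
- by rewrite rmorph1.
- by rewrite rmorphB hx hy.
rewrite rmorphM hx; congr (_ * _).
have [yu|ynu] := boolP (y \is a GRing.unit); first by rewrite rmorphV // hy.
by rewrite invr_out // hy.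
Qed.

HB.instance Definition _ := GRing.isDivringClosed.Build S fixed fixed_divring.

Definition fixed_ring := {s : S | s \in fixed}.

HB.instance Definition _ := SubChoice.on fixed_ring.
HB.instance Definition _ := [SubChoice_isSubIntegralDomain of fixed_ring by <:].

Definition fixed_incl : {rmorphism fixed_ring -> S} := \val.

(* M \cap R is a maximal ideal of R = S^G: if x \in R is invertible modulo M *)
(* with inverse s, then \prod_g (1 - x g(s)) = 1 - x r for some r \in R and  *)
(* this product is in M.                                                     *)
Definition contraction (M : set S) : set fixed_ring := [set r | M (fixed_incl r)].

Lemma contraction_maximal (M : max_ideal S) : is_maximal_ideal (contraction M).
Proof.
have [[M0 MD Ml Mr] M1 Mmax] := max_idealP M.
split.
- split=> [|x y hx hy|b x hx|b x hx]; rewrite /contraction /mkset.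
  + by rewrite (rmorph0 fixed_incl).
  + by rewrite rmorphD; apply: MD.
  + by rewrite rmorphM; apply: Ml.
  + by rewrite rmorphM; apply: Mr.
- by rewrite /contraction /mkset rmorph1.
move=> J [J0 JD Jl Jr] J1 hJ; apply/seteqP; split=> // x Jx; apply: contrapT => Mx.
have x0 : fixed_incl x != 0 by apply/eqP => x0; apply: Mx; rewrite /contraction /mkset x0.
have [s hs] := max_ideal_inv Mx.
have [r hr] : exists r, \prod_g (1 - fixed_incl x * a g s) = 1 - fixed_incl x * r.
  apply: (big_ind (fun p => exists r, p = 1 - fixed_incl x * r)).
  - by exists 0; rewrite mulr0 subr0.
  - move=> p q [r ->] [t ->]; exists (r + t - r * (fixed_incl x * t)).
    by ring.
  - by move=> g _; exists (a g s).
have rfix : r \in fixed.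
  apply/fixedP => h; apply: (mulfI x0).
  have hx : a h (fixed_incl x) = fixed_incl x := elimT (fixedP _) (valP x) h.
  have : a h (\prod_g (1 - fixed_incl x * a g s)) = \prod_g (1 - fixed_incl x * a g s).
    rewrite rmorph_prod /= [RHS](reindex_inj (mulgI h)); apply: eq_bigr => g _.
    by rewrite rmorphB rmorph1 rmorphM hx actM.
  rewrite hr rmorphB rmorph1 rmorphM /= hx => /(congr1 (fun u => 1 - u)).
  by rewrite !subKr.
have [r' hr'] : exists r' : fixed_ring, fixed_incl r' = r by exists (Sub r rfix).
apply: J1; rewrite -(subrK (x * r') 1); apply: JD; last exact: Jr.
apply: hJ; rewrite /contraction /mkset rmorphB rmorph1 rmorphM hr' -hr.
rewrite (bigD1 1%g) //= act1; apply: Mr.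
by rewrite mulrC -opprB -mulN1r; apply: Ml.
Qed.

Definition contract (M : max_ideal S) : max_ideal fixed_ring :=
  MaxIdeal (contraction_maximal M).

Definition residue_map (M : max_ideal S) :
    residue_field (contract M) -> residue_field M :=
  @quot_map _ _ fixed_incl
    (ideal_of_max (contract M)) (ideal_of_max M) (fun x h => h).

HB.instance Definition _ M := GRing.RMorphism.on (@residue_map M).

Definition residually_separable : Prop :=
  forall M : max_ideal S, separable_extension (@residue_map M).

End FixedRing.

(* Normalised 2-cocycles of G with values in the units of S. *)
Record cocycle (gT : finGroupType) (S : comUnitRingType) (a : ring_action gT S) :=
  Cocycle {
    cocycle_fun :> gT -> gT -> S;
    cocycle_unit : forall g h, cocycle_fun g h \is a GRing.unit;
    cocycleP : forall g h k,
      cocycle_fun g h * cocycle_fun (g * h)%g k =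
      a g (cocycle_fun h k) * cocycle_fun g (h * k)%g;
    cocycle1g : forall g, cocycle_fun 1%g g = 1;
    cocycleg1 : forall g, cocycle_fun g 1%g = 1
  }.

Section CrossedProduct.
Variables (gT : finGroupType) (S : comUnitRingType).
Variables (a : ring_action gT S).

(* x stands for \sum_g x(g) U_g. The action and the cocycle only appear in   *)
(* the ring structure, see [monomialM].                                      *)
Definition crossed_product of cocycle a := {ffun gT -> S}.

Variable f : cocycle a.

Local Notation T := (crossed_product f).

HB.instance Definition _ := GRing.Zmodule.on T.

Implicit Types x y z : T.

(* s U_g *)
Definition monomial (s : S) (g : gT) : T :=
  [ffun h => if h == g then s else 0].

Definition crossed_one : T := monomial 1 1%g.

Definition crossed_mul x y : T :=
  [ffun k => \sum_g x g * a g (y (g^-1 * k)%g) * f g (g^-1 * k)%g].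

Lemma crossed_mulDl : left_distributive crossed_mul +%R.
Proof.
move=> x y z; apply/ffunP => k; rewrite !ffunE -big_split /=.
by apply: eq_bigr => g _; rewrite ffunE !mulrDl.
Qed.

Lemma crossed_mulDr : right_distributive crossed_mul +%R.
Proof.
move=> x y z; apply/ffunP => k; rewrite !ffunE -big_split /=.
by apply: eq_bigr => g _; rewrite ffunE rmorphD mulrDr mulrDl.
Qed.

Lemma crossed_mul1 : left_id crossed_one crossed_mul.
Proof.
move=> x; apply/ffunP => k; rewrite ffunE (bigD1 1%g) //= big1 => [|g g1].
  by rewrite ffunE eqxx act1 invg1 mul1g cocycle1g mul1r mulr1 addr0.
by rewrite ffunE (negPf g1) !mul0r.
Qed.

Lemma crossed_mulr1 : right_id crossed_one crossed_mul.
Proof.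
move=> x; apply/ffunP => k; rewrite ffunE (bigD1 k) //= big1 => [|g gk].
  by rewrite ffunE mulVg eqxx rmorph1 cocycleg1 !mulr1 addr0.
rewrite ffunE; case: eqP => [e|_]; last by rewrite rmorph0 mulr0 mul0r.
by case/eqP: gk; rewrite -[g]mulg1 -e mulKVg.
Qed.

Lemma crossed_mulA : associative crossed_mul.
Proof.
move=> x y z; apply/ffunP => k; rewrite !ffunE.
under [RHS]eq_bigr => m _ do rewrite ffunE !mulr_suml.
rewrite [RHS]exchange_big /=; apply: eq_bigr => g _.
rewrite ffunE rmorph_sum /= mulr_sumr mulr_suml.
rewrite [RHS](reindex_inj (mulgI g)) /=; apply: eq_bigr => h _.
rewrite !rmorphM /= mulKg actM invMg -mulgA.
have := cocycleP f g h (h^-1 * (g^-1 * k))%g; rewrite mulKVg => e.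
by rewrite -!mulrA -e; ring.
Qed.

Lemma crossed_one_neq0 : crossed_one != 0.
Proof.
apply/eqP => /ffunP /(_ 1%g); rewrite !ffunE eqxx => /eqP.
by rewrite oner_eq0.
Qed.

HB.instance Definition _ := GRing.Zmodule_isNzRing.Build T
  crossed_mulA crossed_mul1 crossed_mulr1 crossed_mulDl crossed_mulDr crossed_one_neq0.

Lemma monomialM s t g h :
  monomial s g * monomial t h = monomial (s * a g t * f g h) (g * h)%g.
Proof.
apply/ffunP => k; rewrite !ffunE (bigD1 g) //= big1 => [|m mg].
  rewrite !ffunE eqxx addr0; have [->|ne] := eqVneq k (g * h)%g.
    by rewrite mulKg eqxx.
  case: eqP => [e|_]; last by rewrite rmorph0 mulr0 mul0r.
  by case/eqP: ne; rewrite -e mulKVg.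
by rewrite ffunE (negPf mg) !mul0r.
Qed.

Definition base_embed (s : S) : T := monomial s 1%g.

Lemma base_embed_zmod : zmod_morphism base_embed.
Proof.
by move=> s t; apply/ffunP => h; rewrite !ffunE; case: eqP => // _; rewrite subr0.
Qed.

Lemma base_embed_monoid : monoid_morphism base_embed.
Proof. by split=> // s t; rewrite monomialM act1 cocycle1g mulr1 mulg1. Qed.

HB.instance Definition _ :=
  GRing.isZmodMorphism.Build S T base_embed base_embed_zmod.
HB.instance Definition _ :=
  GRing.isMonoidMorphism.Build S T base_embed base_embed_monoid.

Lemma base_embed_comm (s : S) : (forall g, a g s = s) ->
  forall x, base_embed s * x = x * base_embed s.
Proof.
move=> hs x; apply/ffunP => k; rewrite !ffunE (bigD1 1%g) //= big1 => [|g g1].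
  rewrite [RHS](bigD1 k) //= big1 => [|g gk].
    by rewrite !ffunE mulVg !eqxx act1 invg1 mul1g cocycle1g cocycleg1 !mulr1 !addr0
         hs mulrC.
  rewrite ffunE; case: eqP => [e|_]; last by rewrite rmorph0 mulr0 mul0r.
  by case/eqP: gk; rewrite -[g]mulg1 -e mulKVg.
by rewrite ffunE (negPf g1) !mul0r.
Qed.

End CrossedProduct.

Section FractionLift.
Variables (S : idomainType) (F : fieldType) (phi : {rmorphism S -> F}).
Hypothesis phi_inj : injective phi.

Local Notation "x %:F" := (FracField.tofrac x).

Definition frac_lift of injective phi := fun x : {fraction S} =>
  phi (\n_(repr x)) / phi (\d_(repr x)).

Lemma frac_repr (x : {fraction S}) : x = (\n_(repr x))%:F / (\d_(repr x))%:F.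
Proof.
have d0 : (\d_(repr x))%:F != 0 :> {fraction S} by rewrite tofrac_eq0 denom_ratioP.
apply: (mulIf d0); rewrite divfK // -{1}[x]reprK; unlock FracField.tofrac.
apply: etrans (esym (FracField.pi_mul _ _)) _.
apply/eqmodP; rewrite /= FracField.equivfE /FracField.mulf.
by rewrite !numden_Ratio ?oner_eq0 ?mulf_neq0 ?denom_ratioP ?oner_eq0 // !mulr1 mulrC.
Qed.

Lemma frac_liftE (n d : S) : d != 0 ->
  frac_lift phi_inj (n%:F / d%:F) = phi n / phi d.
Proof.
move=> d0; rewrite /frac_lift; set x : {fraction S} := n%:F / d%:F.
have phi0 (u : S) : u != 0 -> phi u != 0.
  by move=> u0; rewrite -(rmorph0 phi) (inj_eq phi_inj).
have e0 : \d_(repr x) != 0 by apply: denom_ratioP.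
have /eqP := frac_repr x; rewrite {1}/x eqr_div ?tofrac_eq0 // -!tofracM tofrac_eq.
move=> /eqP /(congr1 phi); rewrite !rmorphM => e.
by apply/eqP; rewrite eqr_div ?phi0 // [X in X == _]mulrC eq_sym e mulrC.
Qed.

Lemma frac_lift_tofrac (s : S) : frac_lift phi_inj s%:F = phi s.
Proof.
have := @frac_liftE s 1 (oner_neq0 _).
by rewrite !rmorph1 !divr1.
Qed.

Lemma frac_lift_zmod : zmod_morphism (frac_lift phi_inj).
Proof.
move=> x y; rewrite (frac_repr x) (frac_repr y).
set n := \n_(repr x); set d := \d_(repr x); set n' := \n_(repr y); set d' := \d_(repr y).
have d0 : d != 0 by apply: denom_ratioP.
have d'0 : d' != 0 by apply: denom_ratioP.
have phi0 (u : S) : u != 0 -> phi u != 0.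
  by move=> u0; rewrite -(rmorph0 phi) (inj_eq phi_inj).
rewrite -mulNr -tofracN addf_div ?tofrac_eq0 // -!tofracM -tofracD.
rewrite !frac_liftE ?mulf_neq0 // -mulNr addf_div ?phi0 //.
by rewrite rmorphD !rmorphM rmorphN.
Qed.

Lemma frac_lift_monoid : monoid_morphism (frac_lift phi_inj).
Proof.
split=> [|x y].
  by rewrite -(rmorph1 (@FracField.tofrac S)) frac_lift_tofrac rmorph1.
rewrite (frac_repr x) (frac_repr y).
set n := \n_(repr x); set d := \d_(repr x); set n' := \n_(repr y); set d' := \d_(repr y).
have d0 : d != 0 by apply: denom_ratioP.
have d'0 : d' != 0 by apply: denom_ratioP.
rewrite mulf_div -!tofracM !frac_liftE ?mulf_neq0 //.
by rewrite mulf_div !rmorphM.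
Qed.

HB.instance Definition _ :=
  GRing.isZmodMorphism.Build {fraction S} F (frac_lift phi_inj) frac_lift_zmod.
HB.instance Definition _ :=
  GRing.isMonoidMorphism.Build {fraction S} F (frac_lift phi_inj) frac_lift_monoid.

End FractionLift.

Section FractionAction.
Variables (gT : finGroupType) (S : idomainType) (a : ring_action gT S).

Local Notation tofrac := (@FracField.tofrac S).

Lemma tofrac_act_inj g : injective (tofrac \o a g).
Proof. by move=> x y /eqP; rewrite /= tofrac_eq => /eqP /act_inj. Qed.

Definition frac_act (g : gT) : {rmorphism {fraction S} -> {fraction S}} :=
  frac_lift (@tofrac_act_inj g).

Lemma frac_act_tofrac g s : frac_act g (tofrac s) = tofrac (a g s).
Proof. exact: frac_lift_tofrac. Qed.

Lemma frac_act_div g n d :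
  frac_act g (tofrac n / tofrac d) = tofrac (a g n) / tofrac (a g d).
Proof. by rewrite rmorphM fmorphV !frac_act_tofrac. Qed.

Lemma frac_act1 x : frac_act 1%g x = x.
Proof. by rewrite (frac_repr x) frac_act_div !act1. Qed.

Lemma frac_actM g h x : frac_act (g * h)%g x = frac_act g (frac_act h x).
Proof. by rewrite (frac_repr x) !frac_act_div !actM. Qed.

Definition frac_action : ring_action gT {fraction S} :=
  RingAction frac_act1 frac_actM.

Variable f : cocycle a.

Lemma frac_cocycle_unit g h : tofrac (f g h) \is a GRing.unit.
Proof. exact: (rmorph_unit _ (cocycle_unit f g h)). Qed.

Lemma frac_cocycleP g h k :
  tofrac (f g h) * tofrac (f (g * h)%g k) =
  frac_action g (tofrac (f h k)) * tofrac (f g (h * k)%g).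
Proof. by rewrite /= frac_act_tofrac -!tofracM cocycleP. Qed.

Lemma frac_cocycle1g g : tofrac (f 1%g g) = 1.
Proof. by rewrite cocycle1g. Qed.

Lemma frac_cocycleg1 g : tofrac (f g 1%g) = 1.
Proof. by rewrite cocycleg1. Qed.

Definition frac_cocycle : cocycle frac_action :=
  Cocycle frac_cocycle_unit frac_cocycleP frac_cocycle1g frac_cocycleg1.

(* The inclusion of S^f * G in L^f * G, with L the field of fractions of S. *)
Definition crossed_frac (x : crossed_product f) : crossed_product frac_cocycle :=
  [ffun g => tofrac (x g)].

Lemma crossed_frac_zmod : zmod_morphism crossed_frac.
Proof. by move=> x y; apply/ffunP => g; rewrite !ffunE rmorphB. Qed.

Lemma crossed_frac_monoid : monoid_morphism crossed_frac.
Proof.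
split=> [|x y]; apply/ffunP => g; rewrite !ffunE.
  by case: eqP; rewrite ?rmorph1 ?rmorph0.
rewrite rmorph_sum; apply: eq_bigr => h _.
by rewrite !ffunE /= frac_act_tofrac !rmorphM.
Qed.

HB.instance Definition _ := GRing.isZmodMorphism.Build
  (crossed_product f) (crossed_product frac_cocycle) crossed_frac crossed_frac_zmod.
HB.instance Definition _ := GRing.isMonoidMorphism.Build
  (crossed_product f) (crossed_product frac_cocycle) crossed_frac crossed_frac_monoid.

End FractionAction.

Section Completion.
Variables (A : pzRingType) (z : A) (zC : forall x, z * x = x * z).

Lemma power_ideal_subproof n : is_ideal (principal (z ^+ n)).
Proof.
have zxC m x : z ^+ m * x = x * z ^+ m.
  elim: m x => [|m IH] x; first by rewrite expr0 mul1r mulr1.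
  by rewrite exprS -mulrA IH mulrA zC -mulrA.
split.
- by exists 0; rewrite ?mulr0.
- by move=> _ _ [x _ <-] [y _ <-]; exists (x + y); rewrite ?mulrDr.
- by move=> b _ [x _ <-]; exists (b * x); rewrite // !mulrA zxC.
- by move=> b _ [x _ <-]; exists (x * b); rewrite ?mulrA.
Qed.

Definition power_ideal n : ideal A := Ideal (power_ideal_subproof n).

Lemma power_ideal_leS n x : power_ideal n.+1 x -> power_ideal n (idfun x).
Proof. by move=> [y _ <-]; exists (z * y); rewrite // exprSr mulrA. Qed.

Definition transition n : quot_ring (power_ideal n.+1) -> quot_ring (power_ideal n) :=
  quot_map (f := idfun) (@power_ideal_leS n).

HB.instance Definition _ n := GRing.RMorphism.on (@transition n).

(* Compatible families in \prod_n A/z^nA. *)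
Record completion := Completion {
  component :> forall n, quot_ring (power_ideal n);
  componentP : forall n, transition (component n.+1) = component n
}.

HB.instance Definition _ := gen_eqMixin completion.
HB.instance Definition _ := gen_choiceMixin completion.

Implicit Types u v w : completion.

Lemma completion_ext u v : (forall n, u n = v n) -> u = v.
Proof.
case: u v => [u hu] [v hv] /= uv.
have {uv} e : u = v by apply: functional_extensionality_dep.
by case: _ / e in hv *; congr Completion; apply: Prop_irrelevance.
Qed.

Definition completion_zero : completion :=
  @Completion (fun n => 0) (fun n => rmorph0 (@transition n)).

Definition completion_one : completion :=
  @Completion (fun n => 1) (fun n => rmorph1 (@transition n)).

Lemma completion_opp_subproof u n : transition (- u n.+1) = - u n.
Proof. by rewrite -[u n]componentP; apply: rmorphN. Qed.

Definition completion_opp u : completion := Completion (completion_opp_subproof u).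

Lemma completion_add_subproof u v n : transition (u n.+1 + v n.+1) = u n + v n.
Proof. by rewrite -[u n]componentP -[v n]componentP; apply: rmorphD. Qed.

Definition completion_add u v : completion := Completion (completion_add_subproof u v).

Lemma completion_mul_subproof u v n : transition (u n.+1 * v n.+1) = u n * v n.
Proof. by rewrite -[u n]componentP -[v n]componentP; apply: rmorphM. Qed.

Definition completion_mul u v : completion := Completion (completion_mul_subproof u v).

Lemma completion_addA : associative completion_add.
Proof. by move=> u v w; apply: completion_ext => n; apply: addrA. Qed.
Lemma completion_addC : commutative completion_add.
Proof. by move=> u v; apply: completion_ext => n; apply: addrC. Qed.
Lemma completion_add0 : left_id completion_zero completion_add.
Proof. by move=> u; apply: completion_ext => n; apply: add0r. Qed.
Lemma completion_addN : left_inverse completion_zero completion_opp completion_add.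
Proof. by move=> u; apply: completion_ext => n; apply: addNr. Qed.

HB.instance Definition _ := GRing.isZmodule.Build completion
  completion_addA completion_addC completion_add0 completion_addN.

Lemma completion_mulA : associative completion_mul.
Proof. by move=> u v w; apply: completion_ext => n; apply: mulrA. Qed.
Lemma completion_mul1 : left_id completion_one completion_mul.
Proof. by move=> u; apply: completion_ext => n; apply: mul1r. Qed.
Lemma completion_mulr1 : right_id completion_one completion_mul.
Proof. by move=> u; apply: completion_ext => n; apply: mulr1. Qed.
Lemma completion_mulDl : left_distributive completion_mul +%R.
Proof. by move=> u v w; apply: completion_ext => n; apply: mulrDl. Qed.
Lemma completion_mulDr : right_distributive completion_mul +%R.
Proof. by move=> u v w; apply: completion_ext => n; apply: mulrDr. Qed.

HB.instance Definition _ := GRing.Zmodule_isPzRing.Build completion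
  completion_mulA completion_mul1 completion_mulr1 completion_mulDl completion_mulDr.

End Completion.

Section CompletionCom.
Variables (A : comPzRingType) (z : A) (zC : forall x, z * x = x * z).

Lemma completion_mulC : commutative (@GRing.mul (completion zC)).
Proof. by move=> u v; apply: completion_ext => n; apply: mulrC. Qed.

HB.instance Definition _ :=
  GRing.PzRing_hasCommutativeMul.Build (completion zC) completion_mulC.

End CompletionCom.

(* The morphism lim A/z^iA -> lim B/w^iB induced by f : A -> B with f(z) = w. *)
Section CompletionMap.
Variables (A B : pzRingType) (f : {rmorphism A -> B}) (z : A) (w : B).
Variables (zC : forall x, z * x = x * z) (wC : forall x, w * x = x * w).
Hypothesis fz : f z = w.

Lemma power_ideal_map n x : power_ideal zC n x -> power_ideal wC n (f x).
Proof. by move=> [y _ <-]; exists (f y); rewrite // rmorphM rmorphXn fz. Qed.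

Lemma completion_map_subproof (u : completion zC) n :
  transition (quot_map (@power_ideal_map n.+1) (u n.+1)) =
  quot_map (@power_ideal_map n) (u n).
Proof.
rewrite -(componentP u n) -[u n.+1]quot_projK.
by rewrite /transition !quot_mapE.
Qed.

Definition completion_map (u : completion zC) : completion wC :=
  Completion (completion_map_subproof u).

Lemma completion_map_zmod : zmod_morphism completion_map.
Proof. by move=> u v; apply: completion_ext => n; apply: rmorphB. Qed.

Lemma completion_map_monoid : monoid_morphism completion_map.
Proof.
split=> [|u v]; apply: completion_ext => n; first exact: rmorph1.
exact: rmorphM.
Qed.

HB.instance Definition _ := GRing.isZmodMorphism.Build
  (completion zC) (completion wC) completion_map completion_map_zmod.
HB.instance Definition _ := GRing.isMonoidMorphism.Build
  (completion zC) (completion wC) completion_map completion_map_monoid.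

End CompletionMap.

Section Idempotents.
Variable A : pzRingType.

Definition is_idempotent (e : A) : Prop := e * e = e.

Definition is_primitive_idempotent (e : A) : Prop :=
  [/\ is_idempotent e, e <> 0 &
      forall u v, is_idempotent u -> is_idempotent v -> u * v = 0 -> v * u = 0 ->
        e = u + v -> u = 0 \/ v = 0].

Lemma primitive_idempotentW e : is_primitive_idempotent e -> is_idempotent e.
Proof. by case. Qed.

End Idempotents.

Section Corner.
Variables (A : pzRingType) (e : A) (eP : is_idempotent e).

Definition corner_pred of is_idempotent e : A -> bool := fun x => e * x * e == x.

Lemma cornerP x : reflect (e * x * e = x) (x \in corner_pred eP).
Proof. exact: eqP. Qed.

Lemma corner_zmod : zmod_closed (corner_pred eP).
Proof.
split=> [|x y /cornerP hx /cornerP hy]; apply/cornerP; first by rewrite mulr0 mul0r.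
by rewrite mulrBr mulrBl hx hy.
Qed.

HB.instance Definition _ := GRing.isZmodClosed.Build A (corner_pred eP) corner_zmod.

(* eAe = {x | exe = x}; its unit is e. *)
Definition corner := {x : A | x \in corner_pred eP}.

HB.instance Definition _ := SubChoice.on corner.
HB.instance Definition _ := [SubChoice_isSubZmodule of corner by <:].

Lemma corner_sandwich x : e * x * e \in corner_pred eP.
Proof. by apply/cornerP; rewrite !mulrA eP -!mulrA eP. Qed.

Lemma cornerl (x : corner) : e * val x = val x.
Proof. by rewrite -{1}(elimT (cornerP _) (valP x)) !mulrA eP (elimT (cornerP _) (valP x)). Qed.

Lemma cornerr (x : corner) : val x * e = val x.
Proof. by rewrite -{1}(elimT (cornerP _) (valP x)) -!mulrA eP mulrA (elimT (cornerP _) (valP x)). Qed.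

Lemma corner_one_subproof : e \in corner_pred eP.
Proof. by apply/cornerP; rewrite !eP. Qed.

Definition corner_one : corner := Sub e corner_one_subproof.

Lemma corner_mul_subproof (x y : corner) : val x * val y \in corner_pred eP.
Proof. by apply/cornerP; rewrite mulrA cornerl -mulrA cornerr. Qed.

Definition corner_mul (x y : corner) : corner := 
  Sub (val x * val y) (corner_mul_subproof x y).

Lemma corner_mulA : associative corner_mul.
Proof. by move=> x y t; apply: val_inj; rewrite /= mulrA. Qed.
Lemma corner_mul1 : left_id corner_one corner_mul.
Proof. by move=> x; apply: val_inj; apply: cornerl. Qed.
Lemma corner_mulr1 : right_id corner_one corner_mul.
Proof. by move=> x; apply: val_inj; apply: cornerr. Qed.
Lemma corner_mulDl : left_distributive corner_mul +%R.
Proof. by move=> x y t; apply: val_inj; apply: mulrDl. Qed.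
Lemma corner_mulDr : right_distributive corner_mul +%R.
Proof. by move=> x y t; apply: val_inj; apply: mulrDr. Qed.

HB.instance Definition _ := GRing.Zmodule_isPzRing.Build corner
  corner_mulA corner_mul1 corner_mulr1 corner_mulDl corner_mulDr.

(* c |-> phi(c) e, written symmetrically *)
Variables (C : pzRingType) (phi : {rmorphism C -> A}).

Definition corner_map of (forall c, phi c * e = e * phi c) :=
  fun c : C => (Sub (e * phi c * e) (corner_sandwich (phi c)) : corner).

Hypothesis phiC : forall c, phi c * e = e * phi c.

Lemma corner_map_zmod : zmod_morphism (corner_map phiC).
Proof. by move=> c d; apply: val_inj; rewrite /= rmorphB mulrBr mulrBl. Qed.

Lemma corner_map_monoid : monoid_morphism (corner_map phiC).
Proof.
split=> [|c d]; apply: val_inj; rewrite /= ?rmorph1 ?mulr1 ?eP //.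
rewrite -!phiC -![_ * e * e]mulrA eP rmorphM -!mulrA; congr (_ * _).
by rewrite mulrA -phiC -mulrA eP.
Qed.

HB.instance Definition _ :=
  GRing.isZmodMorphism.Build C corner (corner_map phiC) corner_map_zmod.
HB.instance Definition _ :=
  GRing.isMonoidMorphism.Build C corner (corner_map phiC) corner_map_monoid.

End Corner.

(* i identifies A with an order in Q, and Q is its (two-sided, classical) *)
(* quotient ring.                                                         *)
Definition is_quotient_ring (A Q : pzRingType) (i : {rmorphism A -> Q}) : Prop :=
  [/\ injective i,
      (forall s, GRing.lreg s -> GRing.rreg s ->
         exists t, i s * t = 1 /\ t * i s = 1),
      (forall q, exists x s, [/\ GRing.lreg s, GRing.rreg s & i s * q = i x]) &
      (forall q, exists x s, [/\ GRing.lreg s, GRing.rreg s & q * i s = i x])].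

Section Orders.
Variables (C : comPzRingType) (Q : pzRingType) (j : {rmorphism C -> Q}).

(* Q is an algebra over the field of fractions K of the domain C through j. *)
(* The last condition says that K X = Q.                                    *)
Definition is_order (X : set Q) : Prop :=
  [/\ [/\ X 1, (forall x y, X x -> X y -> X (x - y)) &
          (forall x y, X x -> X y -> X (x * y))],
      (exists (n : nat) (s : 'I_n -> Q),
         X = [set x | exists c : 'I_n -> C, x = \sum_i j (c i) * s i]) &
      (forall q, exists2 c : C, c <> 0 & X (j c * q))].

Definition is_maximal_order (X : set Q) : Prop :=
  is_order X /\ forall Y, is_order Y -> X `<=` Y -> Y = X.

End Orders.

Section MainObjects.
Variables (gT : finGroupType) (S : idomainType).
Variables (a : ring_action gT S) (f : cocycle a) (z : fixed_ring a).

Local Notation R := (fixed_ring a).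
Local Notation T := (crossed_product f).

Definition R_to_T : {rmorphism R -> T} := (base_embed f \o fixed_incl a).

Definition R_to_Q : {rmorphism R -> crossed_product (frac_cocycle f)} :=
  (@crossed_frac _ _ _ f \o R_to_T).

Lemma R_to_T_central (x : T) : R_to_T z * x = x * R_to_T z.
Proof. by apply: base_embed_comm => g; apply: (elimT (fixedP _ _) (valP z)). Qed.

Definition R_hat := completion (mulrC z).
Definition S_hat := completion (mulrC (fixed_incl a z)).
Definition T_hat := completion R_to_T_central.

HB.instance Definition _ := GRing.ComPzRing.on R_hat.
HB.instance Definition _ := GRing.ComPzRing.on S_hat.
HB.instance Definition _ := GRing.PzRing.on T_hat.

Definition R_hat_to_S_hat : {rmorphism R_hat -> S_hat} :=
  @completion_map R S (fixed_incl a) z (fixed_incl a z) (mulrC z)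
    (mulrC (fixed_incl a z)) erefl.

Definition S_hat_to_T_hat : {rmorphism S_hat -> T_hat} :=
  @completion_map S T (base_embed f) (fixed_incl a z) (R_to_T z)
    (mulrC (fixed_incl a z)) R_to_T_central erefl.

Definition R_hat_to_T_hat : {rmorphism R_hat -> T_hat} :=
  (S_hat_to_T_hat \o R_hat_to_S_hat).

Section CornerAt.
Variables (e : S_hat) (eP : is_idempotent e).

Lemma S_hat_to_T_hat_idempotent : is_idempotent (S_hat_to_T_hat e).
Proof. by rewrite /is_idempotent -rmorphM eP. Qed.

Lemma R_hat_to_T_hat_comm (c : R_hat) :
  R_hat_to_T_hat c * S_hat_to_T_hat e = S_hat_to_T_hat e * R_hat_to_T_hat c.
Proof. by rewrite /= -!rmorphM mulrC. Qed.

Definition T_corner := corner S_hat_to_T_hat_idempotent.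

HB.instance Definition _ := GRing.PzRing.on T_corner.

Definition R_hat_to_T_corner : {rmorphism R_hat -> T_corner} :=
  corner_map S_hat_to_T_hat_idempotent R_hat_to_T_hat_comm.

End CornerAt.

End MainObjects.

(* Main.v *)
Require Import Defs.
From HB Require Import structures.
From mathcomp Require Import all_boot all_order fingroup all_algebra.
From mathcomp Require Import generic_quotient.
From mathcomp Require Import boolp classical_sets functions cardinality.

Set Implicit Arguments.
Unset Strict Implicit.
Unset Printing Implicit Defensive.

Import GRing.Theory.
Local Open Scope ring_scope.
Local Open Scope classical_set_scope.
Local Open Scope card_scope.

(* Write Q = A[1/z]. The order A is maximal iff there is no additive subgroup *)
(* I of A, other than z^n A itself, with z^n A <= I and I I <= z^n I: this is *)
(* the condition that z^-n I is an overring. It only depends on A/z^(2n)A,    *)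
(* so T and T^ satisfy it simultaneously, and they have the same maximal      *)
(* ideals since these contain z. Any nonzero idempotent e of S^ generates T^  *)
(* as a two-sided ideal (conjugation by the U_g and a norm argument modulo    *)
(* z), so that I |-> eIe is a Morita correspondence between T^ and eT^e, both *)
(* for ideals and for overrings. Finite generation of T over R follows from   *)
(* the faithfulness of the action by a dual basis argument, and it makes      *)
(* every regular element of T^ or eT^e a divisor of some z^n, so that the     *)
(* quotient rings are obtained by inverting z.                                *)

(** For each of the three rings A the ambient quotient ring is A[1/z]. Indeed A is a finite module
    over R or R^, where every nonzero element is a power of z times a unit, so an integral equation
    of a regular element shows that it divides a power of z ([regular_divides_power]); for T, norms
    move the denominators from S to R. An order containing A then has a common denominator z^n, and
    maximality becomes the internal condition [no_overring] ([maximal_orderP]).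

    This condition passes between T and T^ because T/z^n T = T^/z^n T^ ([no_overring_dense]), and
    between T^ and eT^e because T^ e T^ = T^ ([no_overring_corner]). The same two correspondences,
    fed to [card_eq_maximal_ideals], match the maximal two-sided ideals.

    Fullness of e is [idempotent_full]. Modulo z, e comes from some s in S with s^2 - s in zS and s
    not in zS. An ideal of T containing s contains each conjugate g(s), hence 1 - D with D the norm
    of 1 - s. Since s D is in zS, D is not a unit of R, so D is in zR, and an ideal containing both
    s and z contains 1 ([crossed_ideal_unit]). As z is in the radical of T^, this lifts from T^/zT^
    to T^.

    Finiteness of T over R is [crossed_product_fg]: faithfulness yields dual families, which embed a
    multiple of T in a finitely generated module over the principal ring R. *)

Section Ideals.

(** * Two-sided ideals and bijections between maximal ideals *)

Variable A : pzRingType.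
Implicit Types (I J : set A) (e x y z : A).

Definition ideal_sum I z : set A := [set x | exists2 y, I y & exists b, x = y + z * b].

Lemma ideal_sum_ideal I z : (forall x, z * x = x * z) -> is_ideal I ->
  is_ideal (ideal_sum I z).
Proof.
move=> zC [I0 ID Il Ir]; split.
- by exists 0 => //; exists 0; rewrite mulr0 addr0.
- move=> x y [u Iu [b ->]] [v Iv [c ->]]; exists (u + v); first exact: ID.
  by exists (b + c); rewrite mulrDr addrACA.
- move=> c x [u Iu [b ->]]; exists (c * u); first exact: Il.
  by exists (c * b); rewrite mulrDr !mulrA zC.
- move=> c x [u Iu [b ->]]; exists (u * c); first exact: Ir.
  by exists (b * c); rewrite mulrDl !mulrA.
Qed.

Lemma ideal_unit I x y : is_ideal I -> I x -> y * x = 1 -> I 1.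
Proof. by case=> _ _ Il _ Ix <-; apply: Il. Qed.

Lemma idealB I x y : is_ideal I -> I x -> I y -> I (x - y).
Proof. by case=> _ ID Il _ Ix Iy; apply: (ID) => //; rewrite -mulN1r; apply: Il. Qed.

(** The invertibility hypothesis puts z in the radical: if M + zA contained 1, then some 1 - z b
    would be in M, and its left inverse would bring 1 into M. *)
Lemma max_ideal_radical (M : set A) z : (forall x, z * x = x * z) ->
  (forall x, exists y, y * (1 - z * x) = 1) -> is_maximal_ideal M -> M z.
Proof.
move=> zC unit1 [MI M1 Mmax].
have sI := ideal_sum_ideal zC MI.
have sub : M `<=` ideal_sum M z by move=> x Mx; exists x => //; exists 0; rewrite mulr0 addr0.
have [s1|s1] := pselect (ideal_sum M z 1).
  have [m Mm [b e]] := s1; case: M1; have [y hy] := unit1 b.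
  by apply: (ideal_unit MI Mm (y := y)); rewrite -{}[RHS]hy e addrK.
by rewrite -(Mmax _ sI s1 sub); exists 0; [case: MI | exists 1; rewrite mulr1 add0r].
Qed.

End Ideals.

(** Mutually inverse monotone maps that preserve properness also preserve maximality. The upward
    closed classes [P] and [P'] restrict the correspondence to ideals containing z in the case of
    the completion, and are trivial for the corner. *)
Lemma card_eq_maximal_ideals (A B : pzRingType) (P : set A -> Prop) (P' : set B -> Prop)
    (F : set A -> set B) (G : set B -> set A) :
  (forall M, is_maximal_ideal M -> P M) -> (forall M, is_maximal_ideal M -> P' M) ->
  (forall I J, P I -> I `<=` J -> P J) -> (forall I J, P' I -> I `<=` J -> P' J) ->
  (forall I J, I `<=` J -> F I `<=` F J) -> (forall I J, I `<=` J -> G I `<=` G J) ->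
  (forall I, is_ideal I -> P I -> [/\ is_ideal (F I), P' (F I), G (F I) = I & F I 1 -> I 1]) ->
  (forall I, is_ideal I -> P' I -> [/\ is_ideal (G I), P (G I), F (G I) = I & G I 1 -> I 1]) ->
  maximal_ideals A #= maximal_ideals B.
Proof.
move=> mP mP' uP uP' mF mG hF hG; apply/card_set_bijP; exists F; split.
- move=> M Mm; have [MI M1 Mmax] := Mm.
  have [FI PF GF F1] := hF M MI (mP M Mm).
  split=> // [/F1 //|J JI J1 FJ].
  have [GI PG FG G1] := hG J JI (uP' _ _ PF FJ).
  by rewrite -FG (Mmax (G J)) // => [/G1 //|]; rewrite -GF; apply: mG.
- move=> M N /set_mem Mm /set_mem Nm e.
  have [MI _ _] := Mm; have [NI _ _] := Nm.
  have [_ _ <- _] := hF M MI (mP M Mm).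
  by have [_ _ <- _] := hF N NI (mP N Nm); rewrite e.
- move=> M Mm; have [MI M1 Mmax] := Mm.
  have [GI PG FG G1] := hG M MI (mP' M Mm).
  exists (G M) => //; split=> // [/G1 //|J JI J1 GJ].
  have [FI PF GF F1] := hF J JI (uP _ _ PG GJ).
  by rewrite -GF (Mmax (F J)) // => [/F1 //|]; rewrite -FG; apply: mF.
Qed.

(** * Overrings of A in A[1/z] *)

(* The rings Y with A <= Y <= z^-n A in A[1/z] correspond to the subgroups    *)
(* I = z^n Y of A.                                                            *)
Definition overring (A : pzRingType) (z : A) (n : nat) (I : set A) : Prop :=
  [/\ (forall x y, I x -> I y -> I (x - y)), (forall x, I (z ^+ n * x)) &
      forall x y, I x -> I y -> exists2 w, I w & x * y = z ^+ n * w].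

(** As z^n A is contained in I anyway, the inclusion of I in z^n A says that Y = A. *)
Definition no_overring (A : pzRingType) (z : A) : Prop :=
  forall n I, overring z n I -> forall x, I x -> exists y, x = z ^+ n * y.

Section Overring.
Variables (A : pzRingType) (z : A).
Hypotheses (zC : forall x, z * x = x * z) (z_reg : forall x, z * x = 0 -> x = 0).

Lemma exp_central n x : z ^+ n * x = x * z ^+ n.
Proof. by elim: n => [|n IH]; rewrite ?mul1r ?mulr1 // exprS -mulrA IH !mulrA zC. Qed.

Lemma exp_inj n : injective (fun x => z ^+ n * x).
Proof.
move=> x y /= e; apply/subr0_eq; have : z ^+ n * (x - y) = 0 by rewrite mulrBr e subrr.
elim: n {e} => [|n IH]; first by rewrite mul1r.
by rewrite exprS -mulrA => /z_reg.
Qed.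

Variables (n : nat) (I : set A).
Hypothesis IP : overring z n I.

Lemma overring0 : I 0.
Proof. by have [_ zI _] := IP; rewrite -(mulr0 (z ^+ n)); apply: zI. Qed.

Lemma overringD x y : I x -> I y -> I (x + y).
Proof.
move=> Ix Iy; have [IB _ _] := IP; rewrite -(opprK y); apply: (IB) => //.
by rewrite -sub0r; apply: (IB) => //; apply: overring0.
Qed.

(** Y contains A, hence is an A-module: z^n b is in I, and z^n cancels in z^n b x = z^n w. *)
Lemma overring_mull b x : I x -> I (b * x).
Proof.
move=> Ix; have [_ zI IM] := IP; have [w Iw] := IM _ _ (zI b) Ix.
by rewrite -mulrA => /exp_inj ->.
Qed.

Lemma overring_mulr b x : I x -> I (x * b).
Proof.
move=> Ix; have [_ zI IM] := IP; have [w Iw] := IM _ _ Ix (zI b).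
by rewrite mulrA -exp_central -mulrA => /exp_inj ->.
Qed.

End Overring.

(** * Passage to the completion *)

(* B plays the part of the z-adic completion of A. *)
Section DenseMorphism.
Variables (A B : pzRingType) (phi : {rmorphism A -> B}) (z : A) (w : B).
Hypotheses (phi_z : phi z = w).
Hypotheses (zC : forall x, z * x = x * z) (z_reg : forall x, z * x = 0 -> x = 0).
Hypotheses (wC : forall x, w * x = x * w) (w_reg : forall x, w * x = 0 -> x = 0).
(** Purity and density together say that A/z^n A -> B/w^n B is injective and surjective for every
    n. *)
Hypothesis phi_pure : forall n x y, phi x = w ^+ n * y -> exists y', x = z ^+ n * y'.
Hypothesis phi_dense : forall n u, exists x y, u = phi x + w ^+ n * y.

Lemma phi_exp n x : phi (z ^+ n * x) = w ^+ n * phi x.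
Proof. by rewrite rmorphM rmorphXn phi_z. Qed.

(** Overrings are carried from B to A by preimage, and from A to B by I |-> phi(I) + w^n B. *)
Lemma no_overring_dense : no_overring z <-> no_overring w.
Proof.
split=> h n I IP u Iu; have [IB zI IM] := IP.
  have [x [y e]] := phi_dense n u.
  have Ix : I (phi x) by rewrite -(addrK (w ^+ n * y) (phi x)) -e; apply: IB.
  suff [x' ex] : exists y', x = z ^+ n * y' by exists (phi x' + y); rewrite e ex mulrDr -phi_exp.
  apply: (h n (fun x => I (phi x))) => //; split=> [a b Ia Ib|a|a b Ia Ib].
  - by rewrite rmorphB; apply: IB.
  - by rewrite phi_exp.
  have [c Ic ec] := IM _ _ Ia Ib.
  rewrite -rmorphM in ec; have [d ed] := phi_pure ec; exists d => //.
  by move: ec; rewrite ed phi_exp => /(exp_inj w_reg) ->.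
suff [y /phi_pure //] : exists y, phi u = w ^+ n * y.
pose J : set B := [set v | exists2 x, I x & exists b, v = phi x + w ^+ n * b].
apply: (h n J); last by exists u => //; exists 0; rewrite mulr0 addr0.
have JD v v' : J v -> J v' -> J (v + v').
  move=> [x Ix [b ->]] [x' Ix' [b' ->]]; exists (x + x'); first exact: (overringD IP).
  by exists (b + b'); rewrite rmorphD mulrDr addrACA.
split=> [_ _ [x Ix [b ->]] [x' Ix' [b' ->]]|b|_ _ [x Ix [b ->]] [x' Ix' [b' ->]]].
- exists (x - x'); first exact: IB.
  by exists (b - b'); rewrite rmorphB mulrBr opprD addrACA.
- by exists 0; [exact: (overring0 IP) | exists b; rewrite rmorph0 add0r].
(* An element of B is replaced by an approximation from A; the error is in w^n B, which J
   contains. *)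
have Jl c y : I y -> J (c * phi y).
  move=> Iy; have [a [d ->]] := phi_dense n c; exists (a * y).
    exact: (overring_mull z_reg IP).
  by exists (d * phi y); rewrite rmorphM mulrDl -mulrA.
have Jr c y : I y -> J (phi y * c).
  move=> Iy; have [a [d ->]] := phi_dense n c; exists (y * a).
    exact: (overring_mulr zC z_reg IP).
  by exists (phi y * d); rewrite rmorphM mulrDr !mulrA (exp_central wC).
have [v Iv ev] := IM _ _ Ix Ix'.
(* With x x' = z^n v, this is (x + w^n b)(x' + w^n b') divided by w^n. *)
exists (phi v + (b * phi x' + (phi x * b' + w ^+ n * (b * b')))).
  apply: (JD); first by exists v => //; exists 0; rewrite mulr0 addr0.
  apply: (JD); first exact: Jl.
  apply: (JD); first exact: Jr.
  by exists 0; [exact: (overring0 IP) | exists (b * b'); rewrite rmorph0 add0r].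
rewrite mulrDl !mulrDr -rmorphM ev phi_exp -!addrA; congr (_ + _).
rewrite [LHS]addrCA; congr (_ + (_ + _)).
- by rewrite mulrA.
- by rewrite mulrA -(exp_central wC) mulrA.
by rewrite -mulrA; congr (_ * _); rewrite mulrA -(exp_central wC) mulrA.
Qed.

(** The ideals containing z, respectively w, are those of A/zA = B/wB. *)
Lemma card_maximal_ideals_dense :
  (forall M, is_maximal_ideal M -> M z) -> (forall M, is_maximal_ideal M -> M w) ->
  maximal_ideals A #= maximal_ideals B.
Proof.
move=> Mz Mw; pose F (I : set A) : set B := [set u | exists2 x, I x & exists b, u = phi x + w * b].
have phi1 u : exists x y, u = phi x + w * y.
  by have := phi_dense 1 u; rewrite expr1.
have pure1 x y : phi x = w * y -> exists y', x = z * y'.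
  by have := @phi_pure 1 x y; rewrite !expr1.
have memF I x : is_ideal I -> I z -> F I (phi x) -> I x.
  move=> [_ ID _ Ir] Iz [y Iy [b e]].
  have [c ec] : exists c, x - y = z * c.
    by apply: (pure1 _ b); rewrite rmorphB e addrC addKr.
  by rewrite -(subrK y x) ec; apply: (ID) => //; apply: Ir.
apply: (@card_eq_maximal_ideals _ _ (fun I => I z) (fun J => J w) F (fun J => phi @^-1` J)) => //.
- by move=> I J Iz; apply.
- by move=> I J Iz; apply.
- by move=> I J IJ _ [x Ix [b ->]]; exists x; [exact: IJ | exists b].
- by move=> I J IJ x; apply: IJ.
- move=> I II Iz; have [I0 ID Il Ir] := II; split.
  + split.
    * by exists 0 => //; exists 0; rewrite rmorph0 mulr0 addr0.
    * move=> _ _ [x Ix [b ->]] [y Iy [c ->]]; exists (x + y); first exact: ID.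
      by exists (b + c); rewrite rmorphD mulrDr addrACA.
    * move=> c _ [x Ix [b ->]]; have [a [d ->]] := phi1 c.
      exists (a * x); first exact: Il.
      exists (d * phi x + phi a * b + w * (d * b)).
      rewrite rmorphM mulrDl !mulrDr -!addrA; congr (_ + _).
      rewrite [LHS]addrCA; congr (_ + (_ + _)); first by rewrite mulrA.
        by rewrite !mulrA wC.
      by rewrite -mulrA; congr (_ * _); rewrite !mulrA wC.
    * move=> c _ [x Ix [b ->]]; have [a [d ->]] := phi1 c.
      exists (x * a); first exact: Ir.
      exists (phi x * d + b * phi a + w * (b * d)).
      rewrite rmorphM mulrDl !mulrDr -!addrA; congr (_ + _).
      congr (_ + (_ + _)); first by rewrite !mulrA wC.
        by rewrite mulrA.
      by rewrite -mulrA; congr (_ * _); rewrite !mulrA wC.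
  + by exists z => //; exists 0; rewrite mulr0 addr0.
  + apply/seteqP; split=> x; first exact: memF.
    by move=> Ix; exists x => //; exists 0; rewrite mulr0 addr0.
  + by rewrite -(rmorph1 phi); apply: memF.
- move=> J [J0 JD Jl Jr] Jw; split.
  + split=> [|x y Jx Jy|c x Jx|c x Jx]; rewrite /preimage /mkset ?rmorph0 ?rmorphD ?rmorphM.
    * by [].
    * exact: JD.
    * exact: Jl.
    * exact: Jr.
  + by rewrite /preimage /mkset phi_z.
  + apply/seteqP; split=> [_ [x Jx [b ->]]|u Ju]; first by apply: JD => //; apply: Jr.
    have [x [b e]] := phi1 u; exists x; last by exists b.
    rewrite /preimage /mkset -(addrK (w * b) (phi x)) -e; apply: JD => //.
    by rewrite -mulrN; apply: Jr.
  + by rewrite /preimage /mkset rmorph1.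
Qed.

End DenseMorphism.

(** * Morita correspondence for a full idempotent *)

Section FullIdempotent.
Variables (A : pzRingType) (e : A) (eP : is_idempotent e).
Variable s : seq (A * A).
Hypothesis e_full : 1 = \sum_(p <- s) p.1 * e * p.2.

Local Notation eAe := (corner eP).

Definition to_corner (x : A) : eAe := Sub (e * x * e) (corner_sandwich eP x).

(** Expanding both units in y = 1 y 1 recovers y from elements of the corner. *)
Lemma full_expand y :
  y = \sum_(p <- s) \sum_(q <- s) p.1 * (e * (p.2 * y * q.1) * e) * q.2.
Proof.
rewrite -[LHS]mul1r -[LHS]mulr1 {1}e_full mulr_suml [in X in _ * X]e_full mulr_suml.
apply: eq_bigr => p _; rewrite mulr_sumr; apply: eq_bigr => q _.
by rewrite !mulrA.
Qed.

Lemma to_corner_val (x : eAe) : to_corner (val x) = x.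
Proof. by apply: val_inj; rewrite /= cornerl cornerr. Qed.

Lemma to_corner_sandwich a b (x : eAe) :
  to_corner (a * val x * b) = to_corner a * x * to_corner b.
Proof.
by apply: val_inj; rewrite /= -{1}(elimT (cornerP eP _) (valP x)) !mulrA.
Qed.

Lemma to_cornerB : zmod_morphism to_corner.
Proof. by move=> x y; apply: val_inj; rewrite /= mulrBr mulrBl. Qed.

Lemma to_cornerD : {morph to_corner : x y / x + y}.
Proof. by move=> x y; apply: val_inj; rewrite /= mulrDr mulrDl. Qed.

Lemma to_corner0 : to_corner 0 = 0.
Proof. by apply: val_inj; rewrite /= mulr0 mul0r. Qed.

(** The inverse of I |-> eIe sends J to the largest ideal whose corner is in J; compared with the
    generated ideal AJA, this description involves no sums. *)
Lemma card_maximal_ideals_corner : maximal_ideals A #= maximal_ideals eAe.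
Proof.
pose F (I : set A) : set eAe := [set x | I (val x)].
pose G (J : set eAe) : set A := [set y | forall a b, J (to_corner (a * y * b))].
apply: (@card_eq_maximal_ideals _ _ (fun=> True) (fun=> True) F G) => //.
- by move=> I J IJ x; apply: IJ.
- by move=> I J IJ x h a b; apply: IJ.
- move=> I [I0 ID Il Ir] _; split=> //.
  + split=> [|x y Ix Iy|c x Ix|c x Ix]; rewrite /F /mkset.
    * by [].
    * exact: ID.
    * exact: Il.
    * exact: Ir.
  + apply/seteqP; split=> y; last by move=> Iy a b; apply/Ir/Il/Ir/Il.
    move=> Iy; rewrite (full_expand y); apply: big_ind => // p _.
    by apply: big_ind => // q _; apply/Ir/Il/Iy.
  + rewrite /F /mkset /= => Ie; rewrite e_full; apply: big_ind => // p _.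
    by apply/Ir/Il.
- move=> J [J0 JD Jl Jr] _; split=> //.
  + split=> [a b|x y Jx Jy a b|c x Jx a b|c x Jx a b].
    * by rewrite mulr0 mul0r to_corner0.
    * by rewrite mulrDr mulrDl to_cornerD; apply: JD.
    * by rewrite mulrA.
    * by rewrite mulrA -(mulrA _ c).
  + apply/seteqP; split=> x; last by move=> Jx a b; rewrite to_corner_sandwich; apply/Jr/Jl.
    by move=> /(_ 1 1); rewrite mul1r mulr1 to_corner_val.
  + by move=> /(_ 1 1); rewrite !mulr1 (_ : to_corner 1 = 1) //; apply: val_inj; rewrite /= mulr1.
Qed.

Variable z : A.
Hypotheses (zC : forall x, z * x = x * z) (z_reg : forall x, z * x = 0 -> x = 0).

Lemma val_corner_exp n (x : eAe) : val (to_corner z ^+ n * x) = z ^+ n * val x.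
Proof.
elim: n x => [|n IH] x; first by rewrite !mul1r.
rewrite !exprS -!mulrA (_ : forall u v : eAe, val (u * v) = val u * val v) // IH /=.
rewrite -zC -[z * e * e]mulrA eP -!mulrA; congr (_ * _).
by rewrite mulrA -(exp_central zC) -mulrA cornerl.
Qed.

Lemma to_corner_exp n a x b :
  to_corner (a * (z ^+ n * x) * b) = to_corner z ^+ n * to_corner (a * x * b).
Proof. by apply: val_inj; rewrite val_corner_exp /= !mulrA -(exp_central zC) !mulrA. Qed.

Lemma corner_central (x : eAe) : to_corner z * x = x * to_corner z.
Proof.
apply: val_inj; rewrite /= -zC -(mulrA z e e) eP -mulrA cornerl.
by rewrite mulrA -zC -mulrA cornerr.
Qed.

Lemma corner_reg (x : eAe) : to_corner z * x = 0 -> x = 0.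
Proof.
move=> h; apply: val_inj; apply: z_reg; have := val_corner_exp 1 x.
by rewrite !expr1 h.
Qed.

(** An overring I of eAe extends to the y with e a y b e in I for all a, b; an overring I of A
    restricts to eIe. *)
Lemma no_overring_corner : no_overring z <-> no_overring (to_corner z).
Proof.
split=> h n I IP x Ix; have [IB zI IM] := IP.
  pose J : set A := [set y | forall a b, I (to_corner (a * y * b))].
  have JP : overring z n J.
    split=> [u v Ju Jv a b|u a b|u v Ju Jv].
    + by rewrite mulrBr mulrBl to_cornerB; apply: IB.
    + by rewrite to_corner_exp.
    (* Inserting 1 = \sum p.1 e p.2 between u and v divides each sandwich of u v by z^n inside I.
       The quotients are then glued by [full_expand] into one y with u v = z^n y. *)
    have wP a b : {w | I w & to_corner (a * (u * v) * b) = to_corner z ^+ n * w}.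
      apply: cid2.
      pose w p := to_corner (a * u * p.1) * to_corner (p.2 * v * b).
      have -> : to_corner (a * (u * v) * b) = \sum_(p <- s) w p.
        rewrite -(mulr1 u) e_full mulr_sumr mulr_suml mulr_sumr mulr_suml.
        rewrite (big_morph to_corner to_cornerD to_corner0); apply: eq_bigr => p _.
        by apply: val_inj; rewrite /= !mulrA -!(mulrA _ e e) eP.
      have wI p : exists2 w', I w' & w p = to_corner z ^+ n * w'.
        apply: IM; first exact: (Ju a p.1).
        by have := Jv p.2 b.
      elim: (s) => [|p r [w' Iw' IH]].
        by exists 0; [exact: (overring0 IP) | rewrite big_nil mulr0].
      have [w'' Iw'' e''] := wI p; exists (w'' + w'); first exact: (overringD IP).
      by rewrite big_cons IH e'' mulrDr.
    pose w a b := s2val (wP a b).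
    have ew a b : to_corner (a * (u * v) * b) = to_corner z ^+ n * w a b := s2valP' (wP a b).
    pose y := \sum_(p <- s) \sum_(q <- s) p.1 * val (w p.2 q.1) * q.2.
    have ey : u * v = z ^+ n * y.
      rewrite (full_expand (u * v)) mulr_sumr; apply: eq_bigr => p _.
      rewrite mulr_sumr; apply: eq_bigr => q _; have := congr1 val (ew p.2 q.1).
      by rewrite val_corner_exp /= => ->; rewrite !mulrA -(exp_central zC).
    exists y => // a b; have := ew a b; rewrite ey => ew'.
    suff -> : to_corner (a * y * b) = w a b by exact: (s2valP (wP a b)).
    by apply: (@exp_inj _ _ corner_reg n); rewrite -ew' to_corner_exp.
  have [|y ey] := h n J JP (val x).
    move=> a b; rewrite to_corner_sandwich; apply: (overring_mulr corner_central corner_reg IP).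
    exact: (overring_mull corner_reg IP).
  exists (to_corner y); apply: val_inj; rewrite val_corner_exp /= -(elimT (cornerP eP _) (valP x)) ey.
  by rewrite !mulrA -(exp_central zC).
pose J : set eAe := [set y | exists2 x, I x & y = to_corner x].
have cornerJ y : I y -> exists y', e * y * e = z ^+ n * y'.
  move=> Iy; have JP : overring (to_corner z) n J.
    split=> [_ _ [u Iu ->] [v Iv ->]|u|_ _ [u Iu ->] [v Iv ->]].
    + by exists (u - v); [exact: IB | rewrite to_cornerB].
    + exists (z ^+ n * val u) => //; apply: val_inj.
      by rewrite val_corner_exp /= mulrA -(exp_central zC) -!mulrA cornerr cornerl.
    (* (eue)(eve) = e(uev)e, where ue is still in I. *)
    have [w Iw ew] := IM _ _ (overring_mulr zC z_reg IP e Iu) Iv.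
    exists (to_corner w); first by exists w.
    apply: val_inj; rewrite val_corner_exp /= -!mulrA (mulrA e e) eP (mulrA u) (mulrA _ v) ew.
    by rewrite !mulrA (exp_central zC).
  have [|w ew] := h n J JP (to_corner y); first by exists y.
  by exists (val w); rewrite -val_corner_exp -ew.
rewrite (full_expand x).
have {}cornerJ (p q : A * A) : {y | p.1 * (e * (p.2 * x * q.1) * e) * q.2 = z ^+ n * y}.
  apply: cid; have [|y ->] := cornerJ (p.2 * x * q.1).
    exact/(overring_mulr zC z_reg IP)/(overring_mull z_reg IP).
  by exists (p.1 * y * q.2); rewrite !mulrA -(exp_central zC).
exists (\sum_(p <- s) \sum_(q <- s) sval (cornerJ p q)).
rewrite mulr_sumr; apply: eq_bigr => p _; rewrite mulr_sumr; apply: eq_bigr => q _.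
exact: svalP (cornerJ p q).
Qed.

End FullIdempotent.

(** * Finitely generated modules over a principal ideal ring *)

Section Span.
Variables (C : comPzRingType) (A : pzRingType) (eta : {rmorphism C -> A}).
Implicit Types (N : set A) (s : seq A).

Definition is_submodule N : Prop :=
  [/\ N 0, (forall x y, N x -> N y -> N (x + y)) & forall c x, N x -> N (eta c * x)].

(** Recursive, so that finiteness arguments are inductions on the generators; [spanP] converts to
    the linear combinations of [is_order]. *)
Fixpoint span s : set A :=
  if s is x :: s' then [set eta c * x + y | c in setT & y in span s'] else [set 0].

Lemma span_submodule s : is_submodule (span s).
Proof.
elim: s => [|x s [s0 sD sZ]] /=.
  by split=> // [_ _ -> ->|c _ ->]; rewrite ?addr0 ?mulr0.
split.
- by exists 0 => //; exists 0; rewrite // rmorph0 mul0r addr0.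
- move=> _ _ [c _ [y sy <-]] [d _ [t st <-]]; exists (c + d) => //.
  by exists (y + t); [exact: sD | rewrite rmorphD mulrDl addrACA].
- move=> c _ [d _ [t st <-]]; exists (c * d) => //.
  by exists (eta c * t); [exact: sZ | rewrite rmorphM mulrDr mulrA].
Qed.

Lemma submodule_sum N (T : Type) (r : seq T) (F : T -> A) : is_submodule N ->
  (forall t, N (F t)) -> N (\sum_(t <- r) F t).
Proof. by case=> N0 ND _ NF; apply: big_ind. Qed.

Lemma span_sub N s : is_submodule N -> (forall x, x \in s -> N x) -> span s `<=` N.
Proof.
move=> [N0 ND NZ]; elim: s => [|x s IH] Ns /=; first by move=> _ ->.
move=> _ [c _ [y sy <-]]; apply: ND; first by apply/NZ/Ns; rewrite mem_head.
by apply: IH sy => t ts; apply: Ns; rewrite in_cons ts orbT.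
Qed.

Lemma mem_span s x : x \in s -> span s x.
Proof.
elim: s => //= y s IH; rewrite in_cons => /predU1P[->|/IH sx].
  have [s0 _ _] := span_submodule s.
  by exists 1 => //; exists 0; rewrite // rmorph1 mul1r addr0.
by exists 0 => //; exists x; rewrite // rmorph0 mul0r add0r.
Qed.

Lemma spanP s x :
  span s x <-> exists c : 'I_(size s) -> C, x = \sum_i eta (c i) * s`_i.
Proof.
split; last first.
  move=> [c ->]; have sS := span_submodule s; apply: submodule_sum => // i.
  by have [_ _ sZ] := sS; apply/sZ/mem_span/mem_nth.
elim: s x => [x ->|y s IH _ [c _ [t /IH[d ->] <-]]] /=.
  by exists (fun=> 0); rewrite big_ord0.
exists (fun i => if unlift ord0 i is Some j then d j else c).
by rewrite big_ord_recl unlift_none /=; congr (_ + _); apply: eq_bigr => i _; rewrite liftK.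
Qed.

Hypothesis C_principal : forall I : set C, is_ideal I -> exists d, I = principal d.

(** The c such that c x + y is in N for some y in the span of s form an ideal dC. One element of N
    with coefficient d and generators of the intersection of N with that span generate N. *)
Lemma submodule_fg N s : is_submodule N -> N `<=` span s -> exists s', N = span s'.
Proof.
elim: s N => [|x s IH] N NP Ns; have [N0 ND NZ] := NP.
  by exists [::]; apply/seteqP; split=> // _ ->.
have [s0 sD sZ] := span_submodule s.
have NN y : N y -> N (- y) by move/(NZ (- 1)); rewrite rmorphN rmorph1 mulN1r.
have sN y : span s y -> span s (- y) by move/(sZ (- 1)); rewrite rmorphN rmorph1 mulN1r.
pose I : set C := [set c | exists2 y, span s y & N (eta c * x + y)].
have II : is_ideal I.
  have Il c d : I d -> I (c * d).
    move=> [y sy Ny]; exists (eta c * y); first exact: sZ.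
    by rewrite rmorphM -mulrA -mulrDr; apply: NZ.
  split=> [|c d [y sy Ny] [t st Nt]|//|c d]; last by rewrite mulrC; apply: Il.
    by exists 0; rewrite // rmorph0 mul0r addr0.
  exists (y + t); first exact: sD.
  by rewrite rmorphD mulrDl addrACA; apply: ND.
have [d Id] := C_principal II.
have [y sy Ny] : I d by rewrite Id; exists 1; rewrite ?mulr1.
have [|t [Nt st]|s' es'] := IH (N `&` span s) => //.
  split=> // [u v [Nu su] [Nv sv]|c u [Nu su]]; first by split; [apply: ND | apply: sD].
  by split; [apply: NZ | apply: sZ].
exists (eta d * x + y :: s'); apply/seteqP; split=> [v Nv|_ [c _ [t st <-]]]; last first.
  have : span s' t by [].
  by rewrite -es' => -[Nt _]; apply: ND => //; apply: NZ.
have [c _ [t st ev]] := Ns v Nv.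
have [b _ eb] : principal d c by rewrite -Id; exists t => //; rewrite ev.
exists b => //; exists (v - eta b * (eta d * x + y)); last by rewrite addrC subrK.
rewrite -es'; split; first by apply: ND => //; apply/NN/NZ.
rewrite -ev -eb mulrDr mulrA -rmorphM [b * d]mulrC opprD addrACA subrr add0r.
by apply: sD => //; apply/sN/sZ.
Qed.

End Span.

Lemma span_map (C : comPzRingType) (A B : pzRingType) (eta : {rmorphism C -> A})
    (zeta : {rmorphism C -> B}) (h : A -> B) :
  h 0 = 0 -> {morph h : x y / x + y} -> (forall c x, h (eta c * x) = zeta c * h x) ->
  forall s, h @` span eta s = span zeta (map h s).
Proof.
move=> h0 hD hZ; elim=> [|x s IH]; first by rewrite /= image_set1 h0.
apply/seteqP; split=> [_ [_ [c _ [y sy <-]] <-]|_ [c _ [v sv <-]]].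
  exists c => //; exists (h y); last by rewrite hD hZ.
  suff : span zeta (map h s) (h y) by [].
  by rewrite -IH; exists y.
have : span zeta (map h s) v by [].
rewrite -IH => -[y sy <-]; exists (eta c * x + y); last by rewrite hD hZ.
by exists c => //; exists y.
Qed.

(** A form of the discrete valuation property shared by R and R^, the latter carrying only a
    [comPzRingType] structure. *)
Definition is_uniformizer (C : comPzRingType) (z : C) : Prop :=
  forall c, c <> 0 -> exists n u v, c = z ^+ n * u /\ u * v = 1.

(** A nonzero ideal is generated by the least power of z that it contains. *)
Lemma uniformizer_principal (C : comPzRingType) (z : C) : is_uniformizer z ->
  forall I : set C, is_ideal I -> exists d, I = principal d.
Proof.
move=> zP I [I0 ID Il Ir].
have [[c Ic /eqP c0]|noc] := pselect (exists2 c, I c & c != 0); last first.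
  exists 0; apply/seteqP; split=> x; last by move=> [y _ <-]; rewrite mul0r.
  have [-> _|x0 Ix] := eqVneq x 0; first by exists 0; rewrite ?mulr0.
  by case: noc; exists x.
have Iz d : I d -> d <> 0 -> exists n u, I (z ^+ n) /\ d = z ^+ n * u.
  move=> Id /zP[n [u [v [ed uv]]]]; exists n, u; split=> //.
  by rewrite -[z ^+ n]mulr1 -uv mulrA -ed; apply: Ir.
have exn : exists n, `[< I (z ^+ n) >].
  by have [n [_ [In _]]] := Iz c Ic c0; exists n; apply/asboolP.
case: (ex_minnP exn) => n /asboolP In n_min.
exists (z ^+ n); apply/seteqP; split=> x; last by move=> [y _ <-]; apply: Ir.
have [-> _|/eqP x0 Ix] := eqVneq x 0; first by exists 0; rewrite ?mulr0.
have [m [u [Im ->]]] := Iz x Ix x0.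
exists (z ^+ (m - n) * u) => //; rewrite mulrA -exprD subnKC // .
by apply: n_min; apply/asboolP.
Qed.

(** * Integrality over C of a finite C-algebra *)

Section Integrality.
Variables (C : comPzRingType) (A : pzRingType) (eta : {rmorphism C -> A}) (z : C).
Hypothesis zP : is_uniformizer z.
Variable ts : seq A.
Hypothesis A_fg : forall x, span eta ts x.

(** C[s] is a submodule of A, hence finitely generated, hence spanned by the powers of s below some
    n. *)
Lemma integral_power (s : A) :
  exists n (c : nat -> C), s ^+ n = \sum_(k < n) eta (c k) * s ^+ k.
Proof.
pose P n : set A := [set x | exists c : nat -> C, x = \sum_(k < n) eta (c k) * s ^+ k].
have PS n : is_submodule eta (P n).
  split=> [|_ _ [c ->] [d ->]|b _ [c ->]].
  - by exists (fun=> 0); rewrite big1 // => k _; rewrite rmorph0 mul0r.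
  - exists (fun k => c k + d k); rewrite -big_split; apply: eq_bigr => k _.
    by rewrite rmorphD mulrDl.
  - exists (fun k => b * c k); rewrite mulr_sumr; apply: eq_bigr => k _.
    by rewrite rmorphM mulrA.
have PSn n : P n `<=` P n.+1.
  move=> _ [c ->]; exists (fun k => if k == n then 0 else c k).
  rewrite big_ord_recr /= eqxx rmorph0 mul0r addr0; apply: eq_bigr => k _.
  by rewrite ltn_eqF.
have Pmono n m : (n <= m)%N -> P n `<=` P m.
  by move=> /subnK <-; elim: (m - n)%N => // d IH x /IH /PSn.
pose N : set A := [set x | exists n, P n x].
have NS : is_submodule eta N.
  split=> [|x y [n nx] [m my]|c x [n nx]].
  - by exists 0%N; have [] := PS 0%N.
  - exists (maxn n m); have [_ PD _] := PS (maxn n m); apply: PD.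
      by apply: Pmono nx; rewrite leq_maxl.
    by apply: Pmono my; rewrite leq_maxr.
  - by exists n; have [_ _ PZ] := PS n; apply: PZ.
have [|s' es'] := submodule_fg (uniformizer_principal zP) NS (s := ts); first by move=> x _.
have [n hn] : exists n, forall x, x \in s' -> P n x.
  have : forall x, x \in s' -> N x by rewrite es' => x; apply: mem_span.
  elim: s' {es'} => [|x r IH] h; first by exists 0%N.
  have [|n hn] := IH; first by move=> y yr; apply: h; rewrite in_cons yr orbT.
  have [m hm] := h x (mem_head _ _).
  exists (maxn n m) => y; rewrite in_cons => /predU1P[->|/hn].
    by apply: Pmono hm; rewrite leq_maxr.
  by apply: Pmono; rewrite leq_maxl.
suff [c ec] : P n (s ^+ n) by exists n, c.
apply: (span_sub (PS n) hn); rewrite -es'; exists n.+1.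
exists (fun k => if k == n then 1 else 0).
rewrite big_ord_recr /= eqxx rmorph1 mul1r big1 ?add0r // => k _.
by rewrite ltn_eqF // rmorph0 mul0r.
Qed.

(* Solve an integral equation of s for its lowest nonzero coefficient. *)
Lemma regular_divides_power (s : A) : GRing.rreg s -> exists n t, t * s = eta z ^+ n.
Proof.
move=> s_reg; have [n [c /eqP]] := integral_power s.
rewrite -subr_eq0 => /eqP.
have [c' ec'] : exists c', forall k, c' k = - c k by exists (fun k => - c k).
have -> : s ^+ n - \sum_(k < n) eta (c k) * s ^+ k = s ^+ n + \sum_(k < n) eta (c' k) * s ^+ k.
  by congr (_ + _); rewrite -sumrN; apply: eq_bigr => k _; rewrite ec' rmorphN mulNr.
elim: n c' {ec' c} => [|n IH] c.
  rewrite big_ord0 addr0 expr0 => one0; exists 0%N, 0.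
  by rewrite mul0r expr0 one0.
rewrite big_ord_recl expr0 mulr1 addrCA.
set t := s ^+ n + \sum_(k < n) eta (c k.+1) * s ^+ k.
have -> : s ^+ n.+1 + \sum_(i < n) eta (c (lift ord0 i)) * s ^+ lift ord0 i = t * s.
  rewrite mulrDl -exprSr; congr (_ + _); rewrite mulr_suml; apply: eq_bigr => k _.
  by rewrite -mulrA -exprSr.
have [c0|/eqP c0 ets] := eqVneq (c (@ord0 n)) 0.
  rewrite c0 rmorph0 add0r => ts0; apply: (IH (fun k => c k.+1)).
  by apply: s_reg; rewrite ts0 mul0r.
have [m [u [v [ecm uv]]]] := zP c0.
exists m, (- (eta v * t)); rewrite mulNr -mulrA.
have -> : t * s = - eta (c (@ord0 n)) by apply/eqP; rewrite -addr_eq0 addrC ets.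
by rewrite mulrN opprK -rmorphM ecm mulrCA [v * u]mulrC uv mulr1 rmorphXn.
Qed.

End Integrality.

(** * Maximal orders in A[1/z] *)

Section MaximalOrder.
Variables (C : comPzRingType) (A Q : pzRingType).
Variables (eta : {rmorphism C -> A}) (i : {rmorphism A -> Q}) (z : C) (w : Q).
Hypotheses (zP : is_uniformizer z) (A_nz : (1 : A) <> 0).
Hypothesis zC : forall x, eta z * x = x * eta z.
Variable ts : seq A.
Hypothesis A_fg : forall x, span eta ts x.
Hypothesis i_inj : injective i.
Hypotheses (wz : w * i (eta z) = 1) (zw : i (eta z) * w = 1).
Hypothesis Q_frac : forall q, exists n x, i (eta z) ^+ n * q = i x.

Local Notation zQ := (i (eta z)).

Lemma w_exp n : w ^+ n * zQ ^+ n = 1.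
Proof. by rewrite -exprMn_comm ?wz ?expr1n // /GRing.comm wz zw. Qed.

Lemma zw_exp n : zQ ^+ n * w ^+ n = 1.
Proof. by rewrite -exprMn_comm ?zw ?expr1n // /GRing.comm wz zw. Qed.

Lemma zQ_inj n : injective (fun q => zQ ^+ n * q).
Proof. by move=> p q /= /(congr1 ( *%R (w ^+ n))); rewrite !mulrA w_exp !mul1r. Qed.

Lemma zQ_central q : zQ * q = q * zQ.
Proof.
have [n [x e]] := Q_frac q; apply: (@zQ_inj n) => /=.
by rewrite mulrA -exprSr exprS -mulrA e mulrA e -!rmorphM zC.
Qed.

Lemma z_regA x : eta z * x = 0 -> x = 0.
Proof.
move=> e; apply: i_inj; apply: (@zQ_inj 1) => /=.
by rewrite expr1 -rmorphM e !rmorph0 mulr0.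
Qed.

Lemma zexp_neq0 n : z ^+ n <> 0.
Proof.
move=> /(congr1 (i \o eta)) /=; rewrite !rmorphXn !rmorph0 => e.
apply: A_nz; apply: i_inj; rewrite rmorph1 rmorph0.
by rewrite -(w_exp n) e mulr0.
Qed.

Lemma range_is_order : is_order (i \o eta) (range i).
Proof.
split.
- split=> [|_ _ [x _ <-] [y _ <-]|_ _ [x _ <-] [y _ <-]].
  + by exists 1; rewrite ?rmorph1.
  + by exists (x - y); rewrite ?rmorphB.
  + by exists (x * y); rewrite ?rmorphM.
- exists (size ts), (fun k => i ts`_k); apply/seteqP; split=> [_ [x _ <-]|_ [c ->]].
    have [c ->] := (spanP eta ts x).1 (A_fg x); exists c.
    by rewrite rmorph_sum; apply: eq_bigr => k _; rewrite rmorphM.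
  exists (\sum_k eta (c k) * ts`_k) => //.
  by rewrite rmorph_sum; apply: eq_bigr => k _; rewrite rmorphM.
- move=> q; have [n [x e]] := Q_frac q; exists (z ^+ n); first exact: zexp_neq0.
  by exists x; rewrite //= !rmorphXn e.
Qed.

(** An overring I gives the order z^-n I, finitely generated because I is a submodule of A.
    Conversely an order containing A is finitely generated, so a single z^n carries it into A. *)
Lemma maximal_orderP : is_maximal_order (i \o eta) (range i) <-> no_overring (eta z).
Proof.
split=> [[_ Amax] n I IP x Ix|h].
  have [IB zI IM] := IP.
  pose Y : set Q := [set q | exists2 x, I x & zQ ^+ n * q = i x].
  have sub : range i `<=` Y.
    by move=> _ [y _ <-]; exists (eta z ^+ n * y); rewrite // rmorphM rmorphXn.
  have YO : is_order (i \o eta) Y.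
    split.
    - split=> [|p q [u Iu eu] [v Iv ev]|p q [u Iu eu] [v Iv ev]].
      + by apply: sub; exists 1; rewrite ?rmorph1.
      + by exists (u - v); [exact: IB | rewrite mulrBr rmorphB eu ev].
      + have [t It et] := IM _ _ Iu Iv; exists t => //; apply: (@zQ_inj n) => /=.
        rewrite -(rmorphXn i) -rmorphM rmorphXn -et rmorphM -eu -ev.
        by rewrite -[RHS]mulrA; congr (_ * _); rewrite mulrA (exp_central zQ_central) -mulrA.
    - have [|s es] := submodule_fg (uniformizer_principal zP) (N := I) (s := ts) (eta := eta) _ (fun x _ => A_fg x).
        split; [exact: (overring0 IP) | by move=> u v; apply: (overringD IP) |].
        by move=> c u; apply: (overring_mull z_regA IP).
      exists (size s), (fun k => w ^+ n * i s`_k); apply/seteqP.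
      have lin (c : 'I_(size s) -> C) :
          zQ ^+ n * (\sum_k (i \o eta) (c k) * (w ^+ n * i s`_k)) = i (\sum_k eta (c k) * s`_k).
        rewrite mulr_sumr rmorph_sum; apply: eq_bigr => k _.
        rewrite rmorphM /= !mulrA (exp_central zQ_central) -!mulrA; congr (_ * _).
        by rewrite mulrA zw_exp mul1r.
      split=> [q [u Iu eu]|_ [c ->]].
        have [|c ec] := (spanP eta s u).1; first by rewrite -es.
        by exists c; apply: (@zQ_inj n) => /=; rewrite lin eu ec.
      by exists (\sum_k eta (c k) * s`_k); [rewrite es; apply/spanP; exists c | exact: lin].
    - move=> q; have [m [u e]] := Q_frac q; exists (z ^+ m); first exact: zexp_neq0.
      by apply: sub; exists u; rewrite //= !rmorphXn e.
  have [y _ ey] : range i (w ^+ n * i x).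
    rewrite -(Amax Y YO sub); exists x => //.
    by rewrite mulrA zw_exp mul1r.
  exists y; apply: i_inj; rewrite rmorphM rmorphXn ey mulrA.
  by rewrite zw_exp mul1r.
split; first exact: range_is_order.
move=> Y [[Y1 YB YM] [m [s es]] _] sub.
have [n hn] : exists n, forall q, Y q -> exists x, zQ ^+ n * q = i x.
  have [N hN] : exists N : 'I_m -> nat, forall k, exists x, zQ ^+ N k * s k = i x.
    by have [N hN] := choice (fun k => Q_frac (s k)); exists N.
  (* The sum of the exponents of the generators serves as a common exponent. *)
  exists (\sum_k N k)%N => q; rewrite es => -[c ->].
  have [x hx] : exists x : 'I_m -> A, forall k, zQ ^+ (\sum_k N k)%N * s k = i (x k).
    have [|x hx] := choice (P := fun k x => zQ ^+ (\sum_k N k)%N * s k = i x); last by exists x.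
    move=> k; have [x ex] := hN k.
    exists (eta z ^+ (\sum_(j | j != k) N j)%N * x).
    by rewrite (bigD1 k) //= addnC exprD -mulrA ex rmorphM rmorphXn.
  exists (\sum_k eta (c k) * x k); rewrite mulr_sumr rmorph_sum; apply: eq_bigr => k _.
  by rewrite rmorphM -hx !mulrA (exp_central zQ_central).
have Ysub : Y `<=` range i.
  pose I : set A := [set x | exists2 q, Y q & i x = zQ ^+ n * q].
  have IP : overring (eta z) n I.
    split=> [x y [p Yp ep] [q Yq eq]|x|x y [p Yp ep] [q Yq eq]].
    - by exists (p - q); [exact: YB | rewrite rmorphB mulrBr ep eq].
    - by exists (i x); [apply: sub; exists x | rewrite rmorphM rmorphXn].
    have [u eu] := hn _ (YM _ _ Yp Yq).
    exists u; first by exists (p * q); [exact: YM | rewrite eu].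
    apply: i_inj; rewrite !rmorphM rmorphXn ep eq -eu.
    by rewrite -[LHS]mulrA; congr (_ * _); rewrite mulrA -(exp_central zQ_central) -mulrA.
  move=> q Yq; have [x ex] := hn q Yq.
  have [|y ey] := h n I IP x; first by exists q.
  exists y => //; apply: (@zQ_inj n) => /=.
  by rewrite ex ey rmorphM rmorphXn.
by apply/seteqP; split.
Qed.

End MaximalOrder.

Section QuotientRing.
Variables (C : comPzRingType) (A Q : pzRingType).
Variables (eta : {rmorphism C -> A}) (i : {rmorphism A -> Q}) (z : C).
Hypotheses (zP : is_uniformizer z) (A_nz : (1 : A) <> 0).
Hypothesis zC : forall x, eta z * x = x * eta z.
Hypothesis z_reg : forall x, eta z * x = 0 -> x = 0.
Variable ts : seq A.
Hypothesis A_fg : forall x, span eta ts x.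

(** Every quotient ring is A[1/z]: if s q = x with s regular, some t satisfies t s = z^n, whence z^n
    q = t x. *)
Lemma maximal_order_quotient_ring : is_quotient_ring i ->
  is_maximal_order (i \o eta) (range i) <-> no_overring (eta z).
Proof.
move=> [i_inj inv frac _].
have lregz : GRing.lreg (eta z).
  by move=> x y; have := exp_inj z_reg (n := 1); rewrite expr1; apply.
have rregz : GRing.rreg (eta z) by move=> x y; rewrite -!zC; apply: lregz.
have [w [zw wz]] := inv _ lregz rregz.
apply: (maximal_orderP (w := w) zP A_nz zC A_fg i_inj) => // q.
have [x [s [_ s_reg e]]] := frac q.
have [n [t et]] := regular_divides_power zP A_fg s_reg.
by exists n, (t * x); rewrite -rmorphXn -et rmorphM -mulrA e rmorphM.
Qed.

End QuotientRing.

Lemma maximal_ideal_above (C : comPzRingType) (x : C) :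
  (forall y, x * y <> 1) -> exists2 M : set C, is_maximal_ideal M & M x.
Proof.
move=> x_nunit.
(* This is X + xC. The alternative y = 0 admits the empty set, which is the union of the empty chain
   in Zorn's lemma. *)
pose sum (X : set C) : set C := [set u | exists2 y, X y \/ y = 0 & exists b, u = y + x * b].
pose P (X : set C) := [/\ forall u v, X u -> X v -> X (u + v),
  forall c u, X u -> X (c * u) & ~ sum X 1].
have [F FP Ftot|M [[MD MZ M1] Mmax]] := @Zorn_bigcup C P.
  split=> [u v [X FX Xu] [Y FY Yv]|c u [X FX Xu]|[y [[X FX Xy]|->] [b e]]].
  - have [XY|YX] := Ftot _ _ FX FY; [exists Y => //|exists X => //].
      by have [YD _ _] := FP _ FY; apply: YD => //; apply: XY.
    by have [XD _ _] := FP _ FX; apply: XD => //; apply: YX.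
  - by exists X => //; have [_ XZ _] := FP _ FX; apply: XZ.
  - by have [_ _] := FP _ FX; apply; exists y; [left | exists b].
  - by apply: (x_nunit b); rewrite e add0r.
have sumP : P (sum M).
  split=> [_ _ [y My [b ->]] [t Mt [d ->]]|c _ [y My [b ->]]|[u Mu [d e]]].
  - exists (y + t); last by exists (b + d); rewrite mulrDr addrACA.
    have [My' | ->] := My; last by rewrite add0r.
    by have [Mt' | ->] := Mt; [left; apply: MD | rewrite addr0; left].
  - exists (c * y); last by exists (c * b); rewrite mulrDr mulrCA.
    by case: My => [My|->]; [left; apply: MZ | right; rewrite mulr0].
  - apply: M1; case: Mu => [[y My [b eu]]|u0]; last by exists u; [right | exists d].
    by exists y => //; exists (b + d); rewrite e eu mulrDr addrA.
have Msub : M `<=` sum M by move=> y My; exists y; [left | exists 0; rewrite mulr0 addr0].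
have eM : sum M `<=` M.
  move=> y sy; apply: contrapT => nMy; apply: (Mmax (sum M)) sumP.
  by split=> // /(_ y sy).
have M0 : M 0 by apply: eM; exists 0; [right | exists 0; rewrite mulr0 addr0].
have Mx : M x by apply: eM; exists 0; [right | exists 1; rewrite mulr1 add0r].
have MI : is_ideal M by split=> // c u Mu; rewrite mulrC; apply: MZ.
exists M => //; split=> // [/Msub //|J [J0 JD Jl Jr] J1 MJ].
apply/seteqP; split=> // y Jy; apply: contrapT => nMy; apply: (Mmax J).
  by split=> // /(_ y Jy).
split=> // -[u Ju [b e]]; apply: J1; rewrite e; apply: JD; last exact/Jr/MJ.
by case: Ju => [|->].
Qed.

(** * Uniformizers of a discrete valuation ring *)

Section DVR.
Variables (A : idomainType) (z : A).
Hypotheses (A_DVR : is_DVR A) (z_gen : is_maximal_ideal (principal z)).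

Lemma principal_ideal (x : A) : is_ideal (principal x).
Proof.
split.
- by exists 0; rewrite ?mulr0.
- by move=> _ _ [u _ <-] [v _ <-]; exists (u + v); rewrite ?mulrDr.
- by move=> c _ [u _ <-]; exists (c * u); rewrite // mulrCA.
- by move=> c _ [u _ <-]; exists (u * c); rewrite // mulrA.
Qed.

Lemma uniformizer_neq0 : z != 0.
Proof.
apply/eqP => z0; have [_ _ [x x0 xnu]] := A_DVR; have [_ _ zmax] := z_gen.
have x1 : ~ principal x 1.
  by move=> [y _ e]; case/negP: xnu; apply/unitrP; exists y; rewrite mulrC e.
have [y _] : principal z x.
  rewrite -(zmax _ (principal_ideal x) x1); first by exists 1; rewrite ?mulr1.
  by move=> _ [y _ <-]; exists 0; rewrite // z0 mul0r mulr0.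
by rewrite z0 mul0r => /esym/eqP; rewrite (negPf x0).
Qed.

Lemma DVR_unit (x : A) : ~ principal z x -> exists y, x * y = 1.
Proof.
move=> zx; apply: contrapT => nu.
have [|M Mm Mx] := @maximal_ideal_above A x; first by move=> y e; apply: nu; exists y.
have [_ [m [mm m_uniq]] _] := A_DVR.
by apply: zx; rewrite -(m_uniq _ z_gen) (m_uniq _ Mm).
Qed.

(** If x = z^n c_n for all n, then c_n = z c_(n+1) and the ideals (c_n) ascend. Their union is
    principal, so for some n the element c_(n+1) is a multiple of c_n = z c_(n+1); for x nonzero
    this makes z a unit. *)
Lemma DVR_separated (x : A) : (forall n, principal (z ^+ n) x) -> x = 0.
Proof.
move=> zx; apply: contrapT => /eqP x0.
have /choice[c ec] : forall n, exists c, x = z ^+ n * c by move=> n; have [c _ <-] := zx n; exists c.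
have z0 := uniformizer_neq0.
have cS n : c n = z * c n.+1.
  by apply: (mulfI (expf_neq0 n z0)); rewrite -ec mulrA -exprSr -ec.
have cD n m : principal (c (n + m)%N) (c n).
  elim: m => [|m [y _ IH]]; first by rewrite addn0; exists 1; rewrite ?mulr1.
  by rewrite addnS; exists (z * y); rewrite // -IH [in RHS]cS mulrCA mulrA.
pose I : set A := [set u | exists n, principal (c n) u].
have II : is_ideal I.
  have Il d u : I u -> I (d * u).
    by move=> [n [y _ <-]]; exists n; exists (d * y); rewrite // mulrCA.
  split=> [|u v [n [y _ <-]] [m [t _ <-]]|//|d u]; last by rewrite mulrC; apply: Il.
    by exists 0%N; exists 0; rewrite ?mulr0.
  have [y' _ <-] := cD n m; have [t' _ <-] := cD m n.
  by exists (n + m)%N; exists (y' * y + t' * t); rewrite // mulrDr !mulrA [(m + n)%N]addnC.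
have [princ _ _] := A_DVR; have [d Id] := princ I II.
have [n [y _ ed]] : I d by rewrite Id; exists 1; rewrite ?mulr1.
have [t _ et] : principal d (c n.+1).
  by rewrite -Id; exists n.+1; exists 1; rewrite ?mulr1.
have cn0 : c n.+1 != 0 by apply: contraNneq x0 => cn0; rewrite (ec n.+1) cn0 mulr0.
have [_ z1 _] := z_gen; apply: z1; exists (y * t) => //.
by apply: (mulfI cn0); rewrite mulr1 -[RHS]et -ed [in RHS]cS -!mulrA mulrCA.
Qed.

Lemma DVR_uniformizer : is_uniformizer z.
Proof.
move=> c c0; have ex : exists n, ~~ `[< principal (z ^+ n) c >].
  apply: contrapT => h; apply/c0/DVR_separated => n; apply: contrapT => zc.
  by apply: h; exists n; apply/asboolPn.
case: (ex_minnP ex) => -[|n] /asboolPn zc n_min.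
  by case: zc; exists c; rewrite // mul1r.
have [u _ ec] : principal (z ^+ n) c.
  apply: contrapT => zc'; have : (n < n)%N by apply/n_min/asboolPn.
  by rewrite ltnn.
have [|v uv] := @DVR_unit u; last by exists n, u, v.
by move=> [t _ et]; apply: zc; exists t; rewrite // exprSr -mulrA et.
Qed.

End DVR.

(** * The z-adic completion *)

Section CompletionTheory.
Variables (A : pzRingType) (z : A) (zC : forall x, z * x = x * z).

Local Notation Ahat := (completion zC).
Local Notation proj n := (quot_proj (power_ideal zC n)).
Implicit Types (u v : Ahat).

Lemma quot_proj_eq0 (I : ideal A) x : quot_proj I x = 0 <-> I x.
Proof. by rewrite -(quot_proj0 I) quot_proj_eq subr0. Qed.

Lemma transitionE n x : transition (proj n.+1 x) = proj n x.
Proof. exact: quot_mapE. Qed.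

Definition completion_const (x : A) : Ahat :=
  @Completion _ _ zC (fun n => proj n x) (fun n => transitionE n x).

Lemma completion_const_zmod : zmod_morphism completion_const.
Proof. by move=> x y; apply: completion_ext => n; apply: rmorphB. Qed.

Lemma completion_const_monoid : monoid_morphism completion_const.
Proof. by split=> [|x y]; apply: completion_ext => n; [apply: rmorph1 | apply: rmorphM]. Qed.

HB.instance Definition _ :=
  GRing.isZmodMorphism.Build A Ahat completion_const completion_const_zmod.
HB.instance Definition _ :=
  GRing.isMonoidMorphism.Build A Ahat completion_const completion_const_monoid.

Local Notation iota := completion_const.
Local Notation zhat := (iota z).

Lemma component_sum (T : Type) (r : seq T) (F : T -> Ahat) n :
  (\sum_(t <- r) F t) n = \sum_(t <- r) F t n.
Proof. exact: (big_morph (fun u => u n) (id1 := 0) (op1 := +%R)). Qed.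

Lemma component_ge n m u x : (n <= m)%N -> u m = proj m x -> u n = proj n x.
Proof.
move=> /subnK <-; elim: (m - n)%N => // d IH e; apply: IH.
by rewrite -componentP e transitionE.
Qed.

Lemma component_exp_mul n m v x : v m = proj m x -> (zhat ^+ n * v) m = proj m (z ^+ n * x).
Proof.
move=> e; rewrite -rmorphXn -[LHS]/(proj m (z ^+ n) * v m).
by rewrite e rmorphM.
Qed.

Hypothesis z_reg : forall x, z * x = 0 -> x = 0.

(** Representatives x_k of the components n + k of u are of the form z^n y_k, and cancelling z^n
    makes the y_k compatible modulo z^k. Density and purity both follow. *)
Lemma component0P n u : u n = 0 <-> exists v, u = zhat ^+ n * v.
Proof.
split; last first.
  move=> [v ->]; rewrite (component_exp_mul n (esym (quot_projK (v n)))).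
  by apply/quot_proj_eq0; exists (repr (v n)).
move=> un0; pose x k := repr (u (k + n)%N).
have ux k : u (k + n)%N = proj _ (x k) by rewrite quot_projK.
have /choice[y ey] : forall k, exists y, x k = z ^+ n * y.
  move=> k; have /esym := component_ge (leq_addl k n) (ux k).
  by rewrite un0 => /quot_proj_eq0[y _ <-]; exists y.
have yP k : transition (proj k.+1 (y k.+1)) = proj k (y k).
  rewrite transitionE; apply/quot_proj_eq.
  have : power_ideal zC (k + n) (x k.+1 - x k).
    by apply/quot_proj_eq; rewrite -ux; apply/esym/component_ge/ux; rewrite addSn.
  move=> [t _ et]; exists t => //; apply: (exp_inj z_reg (n := n)) => /=.
  by rewrite mulrA -exprD [(n + k)%N]addnC et mulrBr !ey.
exists (Completion yP); apply: completion_ext => k.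
rewrite (component_exp_mul n (v := Completion yP) (x := y k)) // -ey.
exact: component_ge (leq_addr n k) (ux k).
Qed.

Lemma completion_dense n u : exists x v, u = iota x + zhat ^+ n * v.
Proof.
have [|v ev] := (component0P n (u - iota (repr (u n)))).1.
  by rewrite -[LHS]/(u n - proj n (repr (u n))) quot_projK subrr.
by exists (repr (u n)), v; rewrite -ev addrC subrK.
Qed.

Lemma completion_pure n x v : iota x = zhat ^+ n * v -> exists y, x = z ^+ n * y.
Proof.
move=> e; have /quot_proj_eq0[y _ <-] : proj n x = 0; last by exists y.
by apply/(component0P n (iota x)); exists v.
Qed.

Lemma completion_central u : zhat * u = u * zhat.
Proof.
apply: completion_ext => n; rewrite -[LHS]/(proj n z * u n) -[RHS]/(u n * proj n z).
by rewrite -[u n]quot_projK -!rmorphM zC.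
Qed.

Lemma completion_reg u : zhat * u = 0 -> u = 0.
Proof.
move=> e; apply: completion_ext => n.
(* Cancelling z costs one level, so component n is controlled through component n + 1. *)
have : proj n.+1 (z * repr (u n.+1)) = 0.
  rewrite rmorphM -[LHS]/(proj n.+1 z * proj n.+1 (repr (u n.+1))) quot_projK.
  by rewrite -[LHS]/((zhat * u) n.+1) e.
move=> /quot_proj_eq0[y _]; rewrite exprS -mulrA => ey.
rewrite (component_ge (leqnSn n) (esym (quot_projK (u n.+1)))).
apply/quot_proj_eq0; exists y => //; apply: (exp_inj z_reg (n := 1)) => /=.
by rewrite expr1.
Qed.

Lemma geometric_sum (B : pzRingType) (x : B) n :
  (\sum_(k < n) x ^+ k) * (1 - x) = 1 - x ^+ n.
Proof.
elim: n => [|n IH]; first by rewrite big_ord0 mul0r subrr.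
by rewrite big_ord_recr mulrDl IH mulrBr mulr1 -exprSr addrA subrK.
Qed.

(** The inverse is the geometric series in z u, which stops after n terms at level n. *)
Lemma completion_unit u : exists v, v * (1 - zhat * u) = 1.
Proof.
pose c n := (zhat * u) n.
have cn n : c n ^+ n = 0.
  rewrite /c -[_ ^+ n]/((zhat * u) n ^+ n).
  have -> k : (zhat * u) n ^+ k = ((zhat * u) ^+ k) n.
    by elim: k => // k IH; rewrite !exprS IH.
  by apply/component0P; exists (u ^+ n); rewrite exprMn_comm //; apply: completion_central.
have cS n : transition (c n.+1) = c n by exact: componentP.
have vP n : transition (\sum_(k < n.+1) c n.+1 ^+ k) = \sum_(k < n) c n ^+ k.
  rewrite rmorph_sum big_ord_recr /= rmorphXn /= cS cn addr0.
  by apply: eq_bigr => k _; rewrite rmorphXn /= cS.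
exists (Completion vP); apply: completion_ext => n.
rewrite -[LHS]/((\sum_(k < n) c n ^+ k) * (1 - c n)) geometric_sum cn subr0.
by [].
Qed.

Lemma completion_neq0 : ~ principal z 1 -> (1 : Ahat) <> 0.
Proof.
move=> z1 e; apply: z1; have : proj 1 1 = 0 by rewrite -[LHS]/((1 : Ahat) 1) e.
by move=> /quot_proj_eq0; rewrite /= expr1.
Qed.

Lemma series_subproof (r : nat -> A) n :
  transition (proj n.+1 (\sum_(k < n.+1) z ^+ k * r k)) = proj n (\sum_(k < n) z ^+ k * r k).
Proof.
rewrite transitionE big_ord_recr /= rmorphD [X in _ + X](_ : _ = 0) ?addr0 //.
by apply/quot_proj_eq0; exists (r n).
Qed.

Definition completion_series (r : nat -> A) : Ahat := Completion (series_subproof r).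

End CompletionTheory.

Section CompletionUniformizer.
Variables (C : comPzRingType) (z : C).
Hypotheses (z_reg : forall x, z * x = 0 -> x = 0).
Hypothesis C_local : forall x, ~ principal z x -> exists y, x * y = 1.

Local Notation Chat := (completion (mulrC z)).
Local Notation iota := (completion_const (mulrC z)).

(** If n + 1 is the first level where c is nonzero, then c = z^n u with u = x + z v and x not in zC.
    So x has an inverse y, and u y = 1 + z v y is a unit. *)
Lemma completion_uniformizer : is_uniformizer (iota z : Chat).
Proof.
move=> c c0; have ex : exists n, `[< c n <> 0 >].
  apply: contrapT => h; apply: c0; apply: completion_ext => n.
  by apply: contrapT => cn; apply: h; exists n; apply/asboolP.
case: (ex_minnP ex) => -[|n] /asboolP cn n_min.
  (* Level 0 is impossible, as C/z^0 C is the zero ring. *)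
  by case: cn; rewrite -[c 0%N]quot_projK; apply/quot_proj_eq0; eexists; [|exact: mul1r].
have /(component0P z_reg)[u ec] : c n = 0.
  apply: contrapT => cn'; have : (n < n)%N by apply/n_min/asboolP.
  by rewrite ltnn.
have [x [v eu]] := completion_dense z_reg 1 u.
have [|y xy] := C_local (x := x).
  move=> [t _ et]; apply: cn; apply/(component0P z_reg).
  exists (iota t + v); rewrite ec eu -et rmorphM expr1 -mulrDr mulrA.
  by rewrite exprSr.
have [w hw] := completion_unit z_reg (- (v * iota y)).
exists n, u, (iota y * w); split=> //.
rewrite mulrA mulrC -[RHS]hw; congr (_ * _).
by rewrite eu mulrDl -rmorphM xy rmorph1 mulrN opprK expr1 mulrA.
Qed.

End CompletionUniformizer.

Section CompletionFinite.
Variables (C : comPzRingType) (A : pzRingType) (eta : {rmorphism C -> A}).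
Variables (z : C) (zC : forall x, eta z * x = x * eta z).
Hypothesis z_reg : forall x, eta z * x = 0 -> x = 0.

Local Notation Chat := (completion (mulrC z)).
Local Notation Ahat := (completion zC).
Local Notation iota := (completion_const zC).

Variable zeta : {rmorphism Chat -> Ahat}.
Hypothesis zeta_component : forall (c : Chat) n x,
  c n = quot_proj _ x -> zeta c n = quot_proj _ (eta x).

(** Successive approximation: u is expanded over the generators modulo z, then the remainder is, and
    so on; the coefficients obtained for each generator form a z-adic series. *)
Lemma completion_fg ts : (forall x, span eta ts x) -> forall u, span zeta (map iota ts) u.
Proof.
move=> A_fg u; pose m := size ts.
have /choice[F hF] (v : Ahat) : exists p : ('I_m -> C) * Ahat,
    v = iota (\sum_i eta (p.1 i) * ts`_i) + iota (eta z) * p.2.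
  have [x [w ->]] := completion_dense z_reg 1 v.
  by have [r ->] := (spanP eta ts x).1 (A_fg x); exists (r, w); rewrite expr1.
pose U k := iter k (fun v => (F v).2) u.
pose r k i := (F (U k)).1 i.
have eU n : u = iota (\sum_(k < n) eta z ^+ k * \sum_i eta (r k i) * ts`_i)
               + iota (eta z) ^+ n * U n.
  elim: n => [|n IH]; first by rewrite big_ord0 rmorph0 add0r mul1r.
  rewrite {1}IH big_ord_recr rmorphD -addrA; congr (_ + _).
  by rewrite {1}[U n]hF mulrDr rmorphM rmorphXn mulrA -exprSr.
pose c i : Chat := completion_series (mulrC z) (fun k => r k i).
have -> : u = \sum_i zeta (c i) * iota ts`_i.
  apply: completion_ext => n; rewrite component_sum (eU n).
  transitivity (quot_proj (power_ideal zC n) (\sum_(k < n) eta z ^+ k * \sum_i eta (r k i) * ts`_i)).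
    have e0 : (iota (eta z) ^+ n * U n) n = 0 by apply/(component0P z_reg); exists (U n).
    by rewrite -[LHS]/(quot_proj _ _ + (iota (eta z) ^+ n * U n) n) e0 addr0.
  under eq_bigr => k _ do rewrite mulr_sumr.
  rewrite exchange_big rmorph_sum; apply: eq_bigr => i _.
  rewrite -[RHS]/(zeta (c i) n * quot_proj _ ts`_i).
  rewrite (zeta_component (x := \sum_(k < n) z ^+ k * r k i)) // -rmorphM.
  congr quot_proj; rewrite rmorph_sum mulr_suml; apply: eq_bigr => k _.
  by rewrite rmorphM rmorphXn mulrA.
have sS := span_submodule zeta (map iota ts); apply: (submodule_sum _ sS) => i.
by have [_ _ sZ] := sS; apply/sZ/mem_span/map_f/mem_nth.
Qed.

End CompletionFinite.

(* Nakayama's lemma for the finitely generated C-module A/M. *)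
Lemma max_ideal_fg (C : comPzRingType) (A : pzRingType) (eta : {rmorphism C -> A}) (z : C) ts :
  (forall c, exists v, v * (1 - z * c) = 1) -> (forall x, eta z * x = x * eta z) ->
  (forall x, span eta ts x) -> forall M, is_maximal_ideal M -> M (eta z).
Proof.
move=> unit1 zC A_fg M [MI M1 Mmax]; have [M0 MD Ml Mr] := MI.
have sI := ideal_sum_ideal zC MI.
have sub : M `<=` ideal_sum M (eta z).
  by move=> x Mx; exists x => //; exists 0; rewrite mulr0 addr0.
have [s1|s1] := pselect (ideal_sum M (eta z) 1); last first.
  by rewrite -(Mmax _ sI s1 sub); exists 0 => //; exists 1; rewrite mulr1 add0r.
have sT x : ideal_sum M (eta z) x by have [_ _ sl _] := sI; rewrite -(mulr1 x); apply: sl.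
case: M1; suff /(_ ts) h : forall s, (forall x, exists2 m, M m & span eta s (x - m)) -> forall x, M x.
  by apply: h => x; exists 0; rewrite // subr0.
elim=> [|t s IH] hs.
  by move=> x; have [m Mm /eqP] := hs x; rewrite subr_eq0 => /eqP ->.
have [s0 sD sZ] := span_submodule eta s.
apply: IH => x.
(* From t = m + z b and b = m' + c t + y one gets (1 - z c) t = m + z m' + z y, and 1 - z c is
   invertible: the generator t is redundant modulo M. *)
have [mt Mt st] : exists2 m, M m & span eta s (t - m).
  have [m Mm [b et]] := sT t.
  have [m' Mm' [c _ [y sy eb]]] := hs b.
  have [v hv] := unit1 c.
  exists (eta v * (m + eta z * m')); first by apply/Ml/MD => //; apply/Ml.
  suff -> : t - eta v * (m + eta z * m') = eta v * (eta z * y) by apply/sZ/sZ.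
  rewrite -{1}[t]mul1r -(rmorph1 eta) -hv rmorphM -mulrA -mulrBr; congr (_ * _).
  rewrite rmorphB rmorph1 mulrBl mul1r {1}et.
  have -> : b = eta c * t + y + m' by rewrite eb subrK.
  apply/eqP; rewrite !subr_eq !mulrDr rmorphM mulrA; apply/eqP.
  by rewrite addrCA [RHS]addrAC [in RHS](addrC (_ * y)).
have [m Mm [c _ [y sy ex]]] := hs x.
exists (m + eta c * mt); first by apply: MD => //; apply: Ml.
have -> : x - (m + eta c * mt) = eta c * (t - mt) + y.
  by rewrite mulrBr addrAC ex opprD addrA.
by apply: sD => //; apply: sZ.
Qed.

(** * Finiteness and ideals of the crossed product *)

Section CrossedProduct.
Variables (S : idomainType) (gT : finGroupType) (a : ring_action gT S) (f : cocycle a).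

Local Notation R := (fixed_ring a).
Local Notation T := (crossed_product f).

Lemma norm_fixed s : \prod_g a g s \in fixed a.
Proof.
apply/fixedP => h; rewrite rmorph_prod [RHS](reindex_inj (mulgI h)).
by apply: eq_bigr => g _; rewrite actM.
Qed.

Lemma trace_fixed s : \sum_g a g s \in fixed a.
Proof.
apply/fixedP => h; rewrite rmorph_sum [RHS](reindex_inj (mulgI h)).
by apply: eq_bigr => g _; rewrite actM.
Qed.

Lemma norm_neq0 s : s != 0 -> \prod_g a g s != 0.
Proof.
by move=> s0; apply/prodf_neq0 => g _; rewrite -(rmorph0 (a g)) (inj_eq (@act_inj _ _ _ _)).
Qed.

(* The x_J and y_J come from expanding \prod_(g != 1) (h(t_g) - g(t_g)),     *)
(* where g(t_g) != t_g: it vanishes for h != 1.                               *)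
Lemma dual_families : faithful_action a ->
  exists x y : {set gT} -> S, exists2 d, d != 0 &
    forall h, \sum_J x J * a h (y J) = if h == 1%g then d else 0.
Proof.
move=> a_faithful.
have /choice[t ht] : forall g : gT, exists t, g != 1%g -> a g t != t.
  move=> g; have [->|g1] := eqVneq g 1%g; first by exists 0.
  apply: contrapT => h; case/eqP: g1; apply: a_faithful; apply/funext => s.
  rewrite act1; apply: contrapT => /eqP hs; apply: h.
  by exists s.
pose F (h g : gT) : S := if g == 1%g then 1 else a h (t g).
pose G (g : gT) : S := if g == 1%g then 0 else - a g (t g).
exists (fun J : {set gT} => \prod_g (if g \in J then 1 else G g)).
exists (fun J : {set gT} => \prod_g (if g \in J then F 1%g g else 1)).
exists (\prod_g (F 1%g g + G g)).
  apply/prodf_neq0 => g _; rewrite /F /G; case: (eqVneq g 1%g) => [_|g1].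
    by rewrite addr0 oner_neq0.
  by rewrite act1 subr_eq0 eq_sym ht.
move=> h; transitivity (\prod_g (F h g + G g)).
  rewrite bigA_distr; apply: eq_bigr => J _.
  rewrite rmorph_prod -big_split; apply: eq_bigr => g _ /=.
  case: ifP => _; last by rewrite rmorph1 mulr1.
  by rewrite mul1r /F; case: eqP => _; rewrite ?rmorph1 ?act1.
case: eqVneq => [->//|h1]; rewrite (bigD1 h) //= /F /G (negPf h1).
by rewrite subrr mul0r.
Qed.

Lemma base_embedE s (x : T) g : (base_embed f s * x) g = s * x g.
Proof.
rewrite ffunE (bigD1 1%g) //= big1 => [|h h1].
  by rewrite ffunE eqxx act1 invg1 mul1g cocycle1g mulr1 addr0.
by rewrite ffunE (negPf h1) !mul0r.
Qed.

(** The dual families give d s = \sum_J x_J tr(y_J s) for s in S. Multiplying by the other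
    conjugates of d puts D T, with D in R the norm of d, inside a finitely generated R-module; so D
    T is finitely generated, and T is isomorphic to it. *)
Lemma crossed_product_fg : faithful_action a ->
  (forall I : set R, is_ideal I -> exists d, I = principal d) ->
  exists ts, forall x : T, span (R_to_T f) ts x.
Proof.
move=> /dual_families[x [y [d d0 xy]]] R_principal.
pose D : R := Sub (\prod_g a g d) (norm_fixed d).
pose d' := \prod_(g | g != 1%g) a g d.
have DE : fixed_incl a D = d' * d.
  by rewrite /= /d' (bigD1 1%g) //= act1 mulrC.
have D0 : fixed_incl a D != 0 by rewrite /= norm_neq0.
pose tr s : R := Sub (\sum_g a g s) (trace_fixed s).
pose gens : seq T := [seq monomial f (d' * x p.1) p.2 | p <- enum {: {set gT} * gT}].
have TS : is_submodule (R_to_T f) [set R_to_T f D * t | t in setT].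
  split=> [|_ _ [t _ <-] [u _ <-]|c _ [t _ <-]].
  - by exists 0; rewrite ?mulr0.
  - by exists (t + u); rewrite ?mulrDr.
  - by exists (R_to_T f c * t); rewrite // !mulrA R_to_T_central.
have [|s es] := submodule_fg R_principal (s := gens) TS.
  move=> _ [t _ <-].
  have -> : R_to_T f D * t =
      \sum_(p <- enum {: {set gT} * gT}) R_to_T f (tr (y p.1 * t p.2)) * monomial f (d' * x p.1) p.2.
    rewrite big_enum -(pair_big predT predT (fun J g => R_to_T f (tr (y J * t g)) * monomial f (d' * x J) g)) /=.
    apply/ffunP => k; rewrite sum_ffunE base_embedE.
    have xyk : \sum_g (\sum_J x J * a g (y J)) * a g (t k) = d * t k.
      rewrite (bigD1 1%g) //= [X in _ + X]big1 => [|g g1]; last by rewrite xy (negPf g1) mul0r.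
      by rewrite xy eqxx act1 addr0.
    transitivity (\sum_J d' * x J * \sum_g a g (y J * t k)).
      transitivity (d' * \sum_g (\sum_J x J * a g (y J)) * a g (t k)).
        by rewrite xyk mulrA -DE.
      under eq_bigr => g _ do rewrite mulr_suml.
      rewrite exchange_big mulr_sumr; apply: eq_bigr => J _.
      rewrite -[RHS]mulrA; congr (_ * _); rewrite mulr_sumr; apply: eq_bigr => g _.
      by rewrite rmorphM mulrA.
    apply: eq_bigr => J _; rewrite sum_ffunE.
    have coord g : (R_to_T f (tr (y J * t g)) * monomial f (d' * x J) g) k =
        if k == g then d' * x J * \sum_h a h (y J * t g) else 0.
      by rewrite base_embedE ffunE; case: eqP => _; rewrite ?mulr0 // mulrC.
    rewrite (eq_bigr _ (fun g _ => coord g)) [RHS](bigD1 k) //= eqxx [X in _ + X]big1 ?addr0 // => g gk.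
    by rewrite eq_sym (negPf gk).
  have gS := span_submodule (R_to_T f) gens; apply: (submodule_sum _ gS) => p.
  have [_ _ gZ] := gS; apply/gZ/mem_span/mapP; exists p => //; exact: mem_enum.
have /choice[q eq] : forall t, exists u, t \in s -> t = R_to_T f D * u.
  move=> t; have [ts|] := boolP (t \in s); last by exists 0.
  by have : span (R_to_T f) s t := mem_span _ ts; rewrite -es => -[u _ <-]; exists u.
exists (map q s) => t.
have : span (R_to_T f) s (R_to_T f D * t) by rewrite -es; exists t.
have Dinj : injective (fun u : T => R_to_T f D * u).
  move=> u v /ffunP e; apply/ffunP => g; have := e g.
  by rewrite !base_embedE => /(mulfI D0).
have DC c u : R_to_T f D * (R_to_T f c * u) = R_to_T f c * (R_to_T f D * u).
  by rewrite !mulrA R_to_T_central.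
have {eq} : forall u, u \in s -> u = R_to_T f D * q u by [].
clear es; elim: s t => [|u s IH] t eq.
  by move=> e; apply: Dinj; rewrite /= e mulr0.
move=> [c _ [v sv e]].
have [w ew] : exists w, v = R_to_T f D * w.
  exists (t - R_to_T f c * q u); rewrite mulrBr -e {1}(eq u) ?mem_head //.
  by rewrite DC addrAC subrr add0r.
exists c => //; exists w.
  by apply: IH; [move=> u' su'; apply: eq; rewrite in_cons su' orbT | rewrite -ew].
apply: Dinj => /=; rewrite -e ew mulrDr {2}(eq u) ?mem_head //.
by rewrite DC.
Qed.

Lemma crossed_conj (I : set T) s g : is_ideal I ->
  I (base_embed f s) -> I (base_embed f (a g s)).
Proof.
move=> [_ _ Il Ir] Is.
(* Chosen so that c U_(g^-1) is a right inverse of U_g. *)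
pose c := a g^-1%g (f g g^-1%g)^-1.
have -> : base_embed f (a g s) = monomial f 1 g * base_embed f s * monomial f c g^-1%g.
  rewrite !monomialM mul1r mulg1 mulgV cocycleg1 mulr1 -mulrA.
  by rewrite /c -actM mulgV act1 mulVr ?mulr1 // cocycle_unit.
by apply/Ir/Il.
Qed.

Variable z : R.
Hypothesis R_local : forall x : R, ~ principal z x -> exists y, x * y = 1.

(* D = \prod_g g(1 - s) is in R and 1 - D is in I, since I contains all the    *)
(* U_g s U_g^-1 = g(s). Moreover s D is in zS, so D is not a unit of R.        *)
Lemma crossed_ideal_unit (I : set T) (s y : S) : is_ideal I ->
  s * s - s = fixed_incl a z * y -> (forall t, s <> fixed_incl a z * t) ->
  I (base_embed f s) -> I (R_to_T f z) -> I 1.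
Proof.
move=> II e ns Is Iz; have [I0 ID Il Ir] := II.
pose D : R := Sub (\prod_g a g (1 - s)) (norm_fixed (1 - s)).
have DE : fixed_incl a D = \prod_g a g (1 - s) by [].
have sD : s * fixed_incl a D = fixed_incl a z * - (y * \prod_(g | g != 1%g) a g (1 - s)).
  rewrite DE (bigD1 1%g) //= act1 mulrA mulrN mulrA -e -mulNr opprB.
  by rewrite mulrBr mulr1.
have [[r _ eD]|/R_local[v Dv]] := pselect (principal z D); last first.
  case: (ns (- (y * \prod_(g | g != 1%g) a g (1 - s)) * fixed_incl a v)).
  by rewrite mulrA -sD -mulrA -rmorphM Dv rmorph1 mulr1.
have ID1 : I (1 - base_embed f (\prod_g a g (1 - s))).
  apply: (big_ind (fun p => I (1 - base_embed f p))).
  - by rewrite rmorph1 subrr.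
  - move=> p q Ip Iq; have -> : 1 - base_embed f (p * q) =
        (1 - base_embed f p) + base_embed f p * (1 - base_embed f q).
      by rewrite rmorphM mulrBr mulr1 addrA subrK.
    by apply: ID => //; apply: Il.
  - move=> g _; rewrite rmorphB rmorph1 rmorphB rmorph1 subKr.
    exact: crossed_conj.
rewrite -(subrK (base_embed f (\prod_g a g (1 - s))) 1); apply: ID => //.
rewrite -DE -eD -[base_embed f _]/(R_to_T f (z * r)) rmorphM; exact: Ir.
Qed.

Lemma crossed_frac_embed s :
  crossed_frac (base_embed f s) = base_embed (frac_cocycle f) (FracField.tofrac s).
Proof. by apply/ffunP => g; rewrite !ffunE; case: eqP; rewrite ?rmorph0. Qed.

Lemma crossed_frac_inj : injective (@crossed_frac _ _ _ f).
Proof.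
move=> x y /ffunP e; apply/ffunP => g; have := e g.
by rewrite !ffunE => /eqP; rewrite tofrac_eq => /eqP.
Qed.

End CrossedProduct.

Lemma completion_map_component (A B : pzRingType) (h : {rmorphism A -> B}) (z : A) (w : B)
    (zC : forall x, z * x = x * z) (wC : forall x, w * x = x * w) (hz : h z = w)
    (u : completion zC) n x :
  u n = quot_proj _ x -> completion_map wC hz u n = quot_proj _ (h x).
Proof. by move=> e; rewrite /completion_map /= e; apply: quot_mapE. Qed.

(** * The rings T and T^ over a discrete valuation ring R *)

Section Assembly.
Variables (S : idomainType) (gT : finGroupType) (a : ring_action gT S) (f : cocycle a).
Variable z : fixed_ring a.
Hypothesis a_faithful : faithful_action a.
Hypothesis R_DVR : is_DVR (fixed_ring a).
Hypothesis z_gen : is_maximal_ideal (principal z).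

Local Notation R := (fixed_ring a).
Local Notation T := (crossed_product f).
Local Notation iota := (completion_const (@R_to_T_central _ _ _ f z)).
Local Notation zS := (fixed_incl a z).
Local Notation zhat := (completion_const (mulrC z) z : R_hat z).

Lemma R_uniformizer : is_uniformizer z.
Proof. exact: DVR_uniformizer. Qed.

Lemma R_unit (x : R) : ~ principal z x -> exists y, x * y = 1.
Proof. exact: DVR_unit. Qed.

Lemma zS_neq0 : zS != 0.
Proof. by have := uniformizer_neq0 R_DVR z_gen. Qed.

Lemma zS_reg x : zS * x = 0 -> x = 0.
Proof. by move/eqP; rewrite mulf_eq0 (negPf zS_neq0) => /eqP. Qed.

Lemma z_reg x : z * x = 0 -> x = 0.
Proof. by move/eqP; rewrite mulf_eq0 (negPf (uniformizer_neq0 R_DVR z_gen)) => /eqP. Qed.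

Lemma zT_reg (x : T) : R_to_T f z * x = 0 -> x = 0.
Proof.
move=> /ffunP e; apply/ffunP => g; rewrite ffunE; apply: zS_reg.
by have := e g; rewrite base_embedE ffunE.
Qed.

Lemma z_not_unit : ~ principal z 1.
Proof. by case: z_gen. Qed.

(** The coefficient at U_1 of an inverse of z would be an inverse of z in S, and it is fixed by G
    because z is. *)
Lemma zT_not_unit : ~ principal (R_to_T f z) 1.
Proof.
move=> [x _ /ffunP /(_ 1%g)]; rewrite base_embedE ffunE eqxx => ezx.
have z0 : z != 0 := uniformizer_neq0 R_DVR z_gen.
have xfix : x 1%g \in fixed a.
  apply/fixedP => g; apply: (mulfI zS_neq0).
  have <- : a g zS = zS := elimT (fixedP _ _) (valP z) g.
  by rewrite -rmorphM ezx rmorph1 (elimT (fixedP _ _) (valP z) g) ezx.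
apply: z_not_unit; exists (Sub (x 1%g) xfix : R) => //.
exact: val_inj.
Qed.

Lemma T_fg : exists ts, forall x : T, span (R_to_T f) ts x.
Proof. exact/crossed_product_fg/uniformizer_principal/R_uniformizer. Qed.

Lemma maximal_order_T :
  is_maximal_order (R_to_Q f) (range (@crossed_frac gT S a f)) <-> no_overring (R_to_T f z).
Proof.
have [ts ts_gen] := T_fg; have tz0 : FracField.tofrac zS != 0 by rewrite tofrac_eq0 zS_neq0.
pose iQ : {rmorphism T -> crossed_product (frac_cocycle f)} := @crossed_frac gT S a f.
apply: (@maximal_orderP _ _ _ (R_to_T f) iQ z (base_embed (frac_cocycle f) (FracField.tofrac zS)^-1)
  R_uniformizer _ (@R_to_T_central _ _ _ f z) _ ts_gen (@crossed_frac_inj _ _ _ f)).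
- by move/eqP; rewrite oner_eq0.
- by rewrite /= crossed_frac_embed -rmorphM mulVf ?rmorph1.
- by rewrite /= crossed_frac_embed -rmorphM mulfV ?rmorph1.
move=> q.
(* Multiplying numerator and denominator by the other conjugates of d turns the denominator into the
   norm of d, an element of R and so a power of z times a unit. *)
have /choice[N hN] g : exists n, exists s, FracField.tofrac (zS ^+ n) * q g = FracField.tofrac s.
  rewrite (frac_repr (q g)); set d := \d_ _; set n := \n_ _.
  have d0 : d != 0 by apply: denom_ratioP.
  have nd0 : (Sub (\prod_g a g d) (norm_fixed a d) : R) <> 0.
    by move=> /(congr1 (fixed_incl a)) /eqP; rewrite /= (negPf (norm_neq0 a d0)).
  have [m [u [v [eD uv]]]] := R_uniformizer nd0; exists m.
  have {}eD : \prod_g a g d = zS ^+ m * fixed_incl a u.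
    by have := congr1 (fixed_incl a) eD; rewrite rmorphM rmorphXn.
  exists (fixed_incl a v * (\prod_(g | g != 1%g) a g d) * n).
  have -> : zS ^+ m = fixed_incl a v * (\prod_(g | g != 1%g) a g d) * d.
    have -> : fixed_incl a v * (\prod_(g | g != 1%g) a g d) * d = fixed_incl a v * \prod_g a g d.
      by rewrite [in RHS](bigD1 1%g) //= act1 mulrA mulrAC.
    by rewrite eD mulrCA -rmorphM [v * u]mulrC uv rmorph1 mulr1.
  by rewrite !tofracM -!mulrA; congr (_ * (_ * _)); rewrite mulrCA mulfV ?mulr1 // tofrac_eq0.
exists (\sum_g N g)%N.
have /choice[x hx] g : exists s, FracField.tofrac (zS ^+ (\sum_g N g)%N) * q g = FracField.tofrac s.
  have [s es] := hN g; exists (zS ^+ (\sum_(h | h != g) N h)%N * s).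
  by rewrite tofracM -es (bigD1 g) //= addnC exprD tofracM mulrA.
exists ([ffun g => x g] : T); rewrite -rmorphXn -rmorphXn /= crossed_frac_embed.
apply/ffunP => g; rewrite base_embedE !ffunE -hx.
by congr (FracField.tofrac _ * _); rewrite -(rmorphXn (fixed_incl a)).
Qed.

Lemma R_hat_uniformizer : is_uniformizer zhat.
Proof. by apply: completion_uniformizer; [exact: z_reg | exact: R_unit]. Qed.

Lemma R_hat_to_T_hat_component (c : R_hat z) n x :
  c n = quot_proj _ x -> R_hat_to_T_hat f z c n = quot_proj _ (R_to_T f x).
Proof.
move=> e; apply: (@completion_map_component _ _ (base_embed f)).
exact: (@completion_map_component _ _ (fixed_incl a)).
Qed.

Lemma R_hat_to_T_hat_z : R_hat_to_T_hat f z zhat = iota (R_to_T f z).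
Proof. by apply: completion_ext => n; apply: R_hat_to_T_hat_component. Qed.

Lemma S_hat_to_T_hat_const s :
  S_hat_to_T_hat f z (completion_const (mulrC zS) s) = iota (base_embed f s).
Proof.
by apply: completion_ext => n; apply: (@completion_map_component _ _ (base_embed f)).
Qed.

Lemma T_hat_fg : exists ts, forall x : T_hat f z, span (R_hat_to_T_hat f z) ts x.
Proof.
have [ts ts_gen] := T_fg; exists (map iota ts).
exact: (completion_fg zT_reg R_hat_to_T_hat_component ts_gen).
Qed.

Lemma T_hat_unit (u : T_hat f z) : exists v, v * (1 - iota (R_to_T f z) * u) = 1.
Proof. exact: completion_unit zT_reg u. Qed.

Lemma card_maximal_ideals_T_hat : maximal_ideals T #= maximal_ideals (T_hat f z).
Proof.
apply: (@card_maximal_ideals_dense T (T_hat f z) iota _ _ erefl (@completion_central _ _ _)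
  (completion_pure zT_reg) (completion_dense zT_reg)).
  have [ts ts_gen] := T_fg.
  apply: (max_ideal_fg (ts := ts) (eta := R_to_T f)) => // [c|x]; last exact: R_to_T_central.
  have [|v hv] := @R_unit (1 - z * c); last by exists v; rewrite mulrC.
  move=> [x _ e]; apply: z_not_unit; exists (x + c) => //.
  by rewrite mulrDr e subrK.
move=> M; apply: max_ideal_radical; first exact: completion_central.
exact: T_hat_unit.
Qed.

Lemma no_overring_T_hat :
  no_overring (R_to_T f z) <-> no_overring (iota (R_to_T f z) : T_hat f z).
Proof.
exact: (@no_overring_dense T (T_hat f z) iota _ _ erefl (@R_to_T_central _ _ _ f z) zT_reg
  (@completion_central _ _ _) (completion_reg zT_reg) (completion_pure zT_reg)
  (completion_dense zT_reg)).
Qed.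

Lemma T_hat_one_neq0 : (1 : T_hat f z) <> 0.
Proof. exact: (completion_neq0 zT_not_unit). Qed.

Lemma maximal_order_T_hat (Q : pzRingType) (i : {rmorphism T_hat f z -> Q}) :
  is_quotient_ring i ->
  is_maximal_order (i \o R_hat_to_T_hat f z) (range i)
  <-> no_overring (iota (R_to_T f z) : T_hat f z).
Proof.
move=> iP; have [ts ts_gen] := T_hat_fg; rewrite -R_hat_to_T_hat_z.
apply: (maximal_order_quotient_ring R_hat_uniformizer T_hat_one_neq0 _ _ ts_gen iP).
  by move=> x; rewrite R_hat_to_T_hat_z; apply: completion_central.
by move=> x; rewrite R_hat_to_T_hat_z; apply: completion_reg zT_reg x.
Qed.

(** * The corner of T^ at a nonzero idempotent of S^ *)

Section Corner.
Variables (e : S_hat z) (eP : is_idempotent e) (e0 : e <> 0).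

Local Notation eT := (S_hat_to_T_hat f z e).
Local Notation eTP := (S_hat_to_T_hat_idempotent f eP).

(** s represents e modulo z. It is not in zS, for otherwise e = e^n would be in z^n S^ for every n,
    and e would vanish. *)
Lemma idempotent_lift :
  exists s, [/\ exists y, s * s - s = zS * y, forall t, s <> zS * t &
    exists v, e = completion_const (mulrC zS) s + completion_const (mulrC zS) zS * v].
Proof.
have [s [v ev]] := completion_dense zS_reg 1 e; rewrite expr1 in ev.
exists s; split; last by exists v.
  have es : e 1%N = quot_proj _ s.
    apply/eqP; rewrite -subr_eq0; apply/eqP; rewrite -[LHS]/((e - completion_const _ s) 1%N).
    by apply/(component0P zS_reg); exists v; rewrite expr1 {1}ev addrC addKr.
  have : quot_proj (power_ideal (mulrC zS) 1) (s * s) = quot_proj _ s.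
    rewrite rmorphM -[LHS]/(quot_proj (power_ideal (mulrC zS) 1) s * quot_proj _ s) -es.
    by rewrite -[LHS]/((e * e) 1%N) eP.
  by move=> /quot_proj_eq[y _ <-]; exists y; rewrite expr1.
move=> t et; apply: e0.
have [w ew] : exists w, e = completion_const (mulrC zS) zS * w.
  by exists (completion_const (mulrC zS) t + v); rewrite {1}ev et rmorphM mulrDr.
have eX n : e ^+ n.+1 = e by elim: n => // n IH; rewrite exprS IH eP.
apply: completion_ext => n; apply/(component0P zS_reg).
by exists (w ^+ n * e); rewrite -{1}(eX n) exprSr {1}ew exprMn mulrA.
Qed.

(** The preimage in T of I + zT^ contains s and z, hence 1 by [crossed_ideal_unit]. So 1 = j + z b
    with j in I, and j = 1 - z b has a left inverse. *)
Lemma idempotent_full (I : set (T_hat f z)) : is_ideal I -> I eT -> I 1.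
Proof.
move=> II Ie; have [I0 ID Il Ir] := II.
pose K := ideal_sum I (iota (R_to_T f z)).
have KI : is_ideal K by apply: ideal_sum_ideal => // x; apply: completion_central.
have [s [[y es] ns [v ev]]] := idempotent_lift.
have Kz : K (iota (R_to_T f z)) by exists 0 => //; exists 1; rewrite mulr1 add0r.
have [K0 KD Kl Kr] := KI.
suff [j Ij [b ej]] : K 1.
  by have [w hw] := T_hat_unit b; rewrite -hw ej addrK; apply: Il.
rewrite -(rmorph1 iota).
apply: (@crossed_ideal_unit _ _ _ f z R_unit (fun x => K (iota x)) s y _ es ns _ Kz).
  split=> [|x t Kx Kt|c x Kx|c x Kx]; rewrite ?rmorph0 ?rmorphD ?rmorphM.
  - by [].
  - exact: KD.
  - exact: Kl.
  - exact: Kr.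
have -> : iota (base_embed f s) =
    eT - iota (R_to_T f z) * S_hat_to_T_hat f z v.
  rewrite ev rmorphD rmorphM S_hat_to_T_hat_const.
  by rewrite (S_hat_to_T_hat_const zS) addrK.
apply: idealB => //; last by apply: Kr.
by exists eT => //; exists 0; rewrite mulr0 addr0.
Qed.

(** The finite sums of terms a e b form an ideal containing e, to which [idempotent_full]
    applies. *)
Lemma corner_full :
  exists l : seq (T_hat f z * T_hat f z), 1 = \sum_(p <- l) p.1 * eT * p.2.
Proof.
apply: (idempotent_full (I := [set x | exists l : seq (T_hat f z * T_hat f z),
  x = \sum_(p <- l) p.1 * eT * p.2])); last first.
  by exists [:: (1, 1)]; rewrite big_seq1 mul1r mulr1.
split.
- by exists [::]; rewrite big_nil.
- by move=> _ _ [l ->] [m ->]; exists (l ++ m); rewrite big_cat.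
- move=> c _ [l ->]; exists [seq (c * p.1, p.2) | p <- l].
  by rewrite big_map mulr_sumr; apply: eq_bigr => p _; rewrite !mulrA.
- move=> c _ [l ->]; exists [seq (p.1, p.2 * c) | p <- l].
  by rewrite big_map mulr_suml; apply: eq_bigr => p _; rewrite !mulrA.
Qed.

Lemma card_maximal_ideals_T_corner :
  maximal_ideals (T_hat f z) #= maximal_ideals (T_corner f eP).
Proof. by have [l el] := corner_full; apply: card_maximal_ideals_corner el. Qed.

Lemma T_corner_fg : exists ts, forall x : T_corner f eP, span (R_hat_to_T_corner f eP) ts x.
Proof.
have [ts ts_gen] := T_hat_fg; exists (map (to_corner eTP) ts) => x.
have <- := span_map (eta := R_hat_to_T_hat f z) (zeta := R_hat_to_T_corner f eP)
  (to_corner0 eTP) (to_cornerD eTP).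
  by exists (val x); [exact: ts_gen | exact: to_corner_val].
move=> c t; apply: val_inj.
have cC := R_hat_to_T_hat_comm f e c; have EE : eT * eT = eT := eTP.
rewrite -[LHS]/(eT * (R_hat_to_T_hat f z c * t) * eT).
rewrite -[RHS]/(eT * R_hat_to_T_hat f z c * eT * (eT * t * eT)).
by rewrite !mulrA -cC -(mulrA _ eT eT) EE -(mulrA _ eT eT) EE.
Qed.

Lemma R_hat_to_T_corner_z : R_hat_to_T_corner f eP zhat = to_corner eTP (iota (R_to_T f z)).
Proof. by apply: val_inj; rewrite /= -R_hat_to_T_hat_z. Qed.

Lemma maximal_order_T_corner (Q : pzRingType) (i : {rmorphism T_corner f eP -> Q}) :
  is_quotient_ring i ->
  is_maximal_order (i \o R_hat_to_T_corner f eP) (range i)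
  <-> no_overring (iota (R_to_T f z) : T_hat f z).
Proof.
move=> iP; have [ts ts_gen] := T_corner_fg; have [l el] := corner_full.
have hC := @completion_central _ _ (@R_to_T_central _ _ _ f z).
have hreg := @completion_reg _ _ (@R_to_T_central _ _ _ f z) zT_reg.
rewrite (no_overring_corner eTP el hC hreg) -R_hat_to_T_corner_z.
apply: (maximal_order_quotient_ring R_hat_uniformizer _ _ _ ts_gen iP).
(* The unit of the corner is the image of e in T^; if it vanished, the zero ideal would contain it
   and hence 1. *)
- move=> /(congr1 val) /= eT0; apply: T_hat_one_neq0.
  have := @idempotent_full [set x | x = 0]; apply=> //; split=> // [x y -> ->|c x ->|c x ->].
  + by rewrite addr0.
  + by rewrite mulr0.
  + by rewrite mul0r.
- by move=> x; rewrite R_hat_to_T_corner_z; apply: corner_central hC x.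
- by move=> x; rewrite R_hat_to_T_corner_z; apply: corner_reg hC hreg x.
Qed.

End Corner.

End Assembly.

Theorem theorem4p1 (S : idomainType) (S_dedekind : is_dedekind S)
    (gT : finGroupType) (a : ring_action gT S) (a_faithful : faithful_action a)
    (R_DVR : is_DVR (fixed_ring a))
    (S_R_residually_separable : residually_separable a)
    (f : cocycle a)
    (z : fixed_ring a) (z_generator : is_maximal_ideal (principal z))
    (e1 : S_hat z) (e1_primitive : is_primitive_idempotent e1) :
  let e1_idem := primitive_idempotentW e1_primitive in
  (forall (Q_hat : pzRingType) (i_hat : {rmorphism T_hat f z -> Q_hat})
          (Q1 : pzRingType) (i1 : {rmorphism T_corner f e1_idem -> Q1}),
     is_quotient_ring i_hat -> is_quotient_ring i1 ->
     [<-> is_maximal_order (R_to_Q f) (range (@crossed_frac gT S a f));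
          is_maximal_order (i_hat \o R_hat_to_T_hat f z) (range i_hat);
          is_maximal_order (i1 \o R_hat_to_T_corner f e1_idem) (range i1)])
  /\
  (maximal_ideals (crossed_product f) #= maximal_ideals (T_hat f z)
   /\ maximal_ideals (T_hat f z) #= maximal_ideals (T_corner f e1_idem)).
Proof.
move=> e1_idem; have e1_neq0 : e1 <> 0 by case: (e1_primitive).
split=> [Q_hat i_hat Q1 i1 i_hatP i1P|].
  have T_P := maximal_order_T f a_faithful R_DVR z_generator.
  have hat_P := maximal_order_T_hat a_faithful R_DVR z_generator i_hatP.
  have corner_P := maximal_order_T_corner a_faithful R_DVR z_generator e1_neq0 i1P.
  have T_hat_P := no_overring_T_hat f R_DVR z_generator.
  tfae; tauto.
split; first exact: card_maximal_ideals_T_hat.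
exact: card_maximal_ideals_T_corner.
Qed.
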